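(* Let $B$ be a Blaschke product with zero set $\Lambda$. Let $\mathcal{A}$ be the collection of dyadic Whitney squares $Q$ such that $N(Q)=\#(\Lambda\cap Q)>0$. Let $H\in\mathrm{Har}_+(\mathbb{D})$. Assume that there exists $H_1\in\mathrm{Har}_+(\mathbb{D})$ such that $N(Q)H(z(Q))\leq H_1(z(Q))$ for any $Q\in\mathcal{A}$. Then the function $-\log|B|$ has a harmonic majorant on the set $\{z\in\mathbb{D}:\rho(z,\Lambda)\geq e^{-H(z)}\}$.
   Context: $\mathbb{D}$ is the open unit disc of $\mathbb{C}$. $\mathrm{Har}_+(\mathbb{D})$ is the cone of positive harmonic functions in $\mathbb{D}$. The pseudohyperbolic distance is $\rho(a_1,a_2)=\left|\frac{a_1-a_2}{1-\overline{a_2}a_1}\right|$, and $\rho(z,\Lambda)=\inf_{\lambda\in\Lambda}\rho(z,\lambda)$. A function $F$ with values in $[0,+\infty)$ has a harmonic majorant on a set $E\subset\mathbb{D}$ if there exists $H_2\in\mathrm{Har}_+(\mathbb{D})$ such that $F(z)\leq H_2(z)$ for all $z\in E$ (only the values of $F$ on $E$ matter). The dyadic Whitney squares are $$Q_{k,j}=\{re^{i\theta}\in\mathbb{D}:2^{-k}\leq 1-r<2^{-k+1},\ j2\pi2^{-k}\leq\theta<(j+1)2\pi2^{-k}\},\quad k\geq0,\ j=0,\ldots,2^k-1.$$ For a dyadic Whitney square $Q$, $z(Q)$ denotes its center, and $N(Q)=\#(\Lambda\cap Q)$ is the number of points of the sequence $\Lambda$ (zeros counted with multiplicity) in $Q$.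 *)

(* Defs.v *)
From Stdlib Require Import Reals List.
From Coquelicot Require Import Coquelicot.
Open Scope R_scope.

Definition unit_disc (z : C) : Prop := Cmod z < 1.

Definition slice_x (u : C -> R) (z : C) : R -> R := fun x => u (x, Im z).
Definition slice_y (u : C -> R) (z : C) : R -> R := fun y => u (Re z, y).

Definition partial_x (u : C -> R) (z : C) : R := Derive (slice_x u z) (Re z).
Definition partial_y (u : C -> R) (z : C) : R := Derive (slice_y u z) (Im z).

(* [Derive] is total, so existence of the partial derivatives is required
   separately.  These notions are meant for open [D] only. *)
Definition C1_on (D : C -> Prop) (u : C -> R) : Prop :=
  forall z, D z ->
    ex_derive (slice_x u z) (Re z) /\ ex_derive (slice_y u z) (Im z) /\
    continuous (partial_x u) z /\ continuous (partial_y u) z.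

Definition C2_on (D : C -> Prop) (u : C -> R) : Prop :=
  C1_on D u /\ C1_on D (partial_x u) /\ C1_on D (partial_y u).

Definition laplacian (u : C -> R) (z : C) : R :=
  partial_x (partial_x u) z + partial_y (partial_y u) z.

Definition harmonic_on (D : C -> Prop) (u : C -> R) : Prop :=
  C2_on D u /\ forall z, D z -> laplacian u z = 0.

(* Values of [u] outside the disc are irrelevant. *)
Definition Har_plus (u : C -> R) : Prop :=
  harmonic_on unit_disc u /\ forall z, unit_disc z -> 0 < u z.

(* [F] may take the value +oo; on [E] this is then excluded by the bound. *)
Definition has_harmonic_majorant (F : C -> Rbar) (E : C -> Prop) : Prop :=
  exists H2 : C -> R, Har_plus H2 /\ forall z, E z -> Rbar_le (F z) (H2 z).

Definition pseudohyp (a1 a2 : C) : R :=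
  Cmod ((a1 - a2) / (1 - Cconj a2 * a1))%C.

(* A zero sequence, with multiplicity: each index [n] with [lam n = Some l]
   contributes one zero at [l], while [None] contributes nothing.  Empty, finite
   and infinite sequences are all covered. *)
Definition zero_seq : Type := nat -> option C.

Definition is_zero_of (lam : zero_seq) (l : C) : Prop :=
  exists n, lam n = Some l.

(* For an empty sequence this is +oo. *)
Definition pseudohyp_dist (z : C) (lam : zero_seq) : Rbar :=
  Glb_Rbar (fun x => exists l, is_zero_of lam l /\ x = pseudohyp z l).

Definition blaschke_factor (l z : C) : C :=
  if Req_EM_T (Cmod l) 0 then z
  else (RtoC (Cmod l) / l * ((l - z) / (1 - Cconj l * z)))%C.

Fixpoint blaschke_partial (lam : zero_seq) (n : nat) (z : C) : C :=
  match n with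
  | O => RtoC 1
  | S m =>
      (blaschke_partial lam m z *
       match lam m with Some l => blaschke_factor l z | None => RtoC 1 end)%C
  end.

Definition blaschke_condition (lam : zero_seq) : Prop :=
  ex_series (fun n => match lam n with Some l => 1 - Cmod l | None => 0 end).

Definition is_blaschke_product (B : C -> C) (lam : zero_seq) : Prop :=
  (forall l, is_zero_of lam l -> unit_disc l) /\
  blaschke_condition lam /\
  exists c : C, Cmod c = 1 /\
    forall z, unit_disc z ->
      filterlim (fun n => (c * blaschke_partial lam n z)%C)
        eventually (locally (B z)).

(* Stdlib has [ln 0 = 0], so the value at a zero of [B] is set to +oo by hand. *)
Definition neg_log_abs (B : C -> C) (z : C) : Rbar :=
  if Req_EM_T (Cmod (B z)) 0 then p_infty else Finite (- ln (Cmod (B z))).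

Definition polar (r t : R) : C := (r * cos t, r * sin t).

(* For [k = 0] the only square is the singleton of the origin. *)
Definition whitney (k j : nat) (z : C) : Prop :=
  exists r t : R,
    z = polar r t /\ 0 <= r < 1 /\
    / 2 ^ k <= 1 - r < 2 * / 2 ^ k /\
    INR j * (2 * PI * / 2 ^ k) <= t < (INR j + 1) * (2 * PI * / 2 ^ k).

(* Midpoint in polar coordinates; the maximum is only active for [k = 0], where
   it gives the origin. *)
Definition whitney_center (k j : nat) : C :=
  polar (Rmax 0 (1 - 3 / 2 * / 2 ^ k)) ((INR j + 1 / 2) * (2 * PI * / 2 ^ k)).

(* [N] is the number of zeros in [Q], counted with multiplicity.  Under the
   Blaschke condition such an [N] exists for every Whitney square. *)
Definition zero_count (lam : zero_seq) (Q : C -> Prop) (N : nat) : Prop :=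
  exists s : list nat,
    NoDup s /\ length s = N /\
    forall n, In n s <-> exists l, lam n = Some l /\ Q l.

(* Main.v *)
Require Import Defs.
From Stdlib Require Import Reals Lra Lia List ZArith ClassicalEpsilon.
From Coquelicot Require Import Coquelicot.
Import ListNotations.
Open Scope R_scope.

(* For [l] in the disc put [P_l z = Re (2 / (1 - conj l z)) - 1], a positive
   harmonic function with [1 - rho (z, l)^2 <= (1 - |l|^2) P_l z].  Zeros with
   [rho (z, l) >= 1/3] satisfy [- ln rho <= 9/2 (1 - rho^2)], so together they
   contribute at most the harmonic function [9/2 sum (1 - |l|^2) P_l].
   The remaining zeros lie in at most 99 Whitney squares, whatever [z] is; each
   such zero contributes at most [H z], because [rho (z, Lambda) >= exp (- H z)],
   and by Harnack's inequality and the hypothesis the zeros in a square [Q]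
   contribute at most [N(Q) H(z) <= C N(Q) H(z(Q)) <= C H1(z(Q)) <= C^2 H1(z)].

   Harnack's inequality follows by integrating the gradient bound
   [|a u_x + b u_y| <= 4 u / (1 - |c|)], [a^2 + b^2 <= 1], at [c], which says
   that the mean of [u] over a circle about [c] with the nonnegative weight
   [1 + a cos t + b sin t] is nonnegative. *)

(** * C1 functions and harmonic functions of two real variables *)

(** Why circular means: [Har_plus] supplies only classical second derivatives. For W(r), the
    integral of u over the circle of radius r against a weight k(t), the Laplace equation becomes r
    (r W')' = - (integral of u against k''). The weights 1 and a cos t + b sin t turn this into
    ordinary differential equations, whose solutions regular at 0 are the constants and the
    multiples of r.

    Why P_l: unlike the Poisson kernel at l/|l|, it makes sense at l = 0, and it is affine in the
    real part of a function holomorphic in z, so sums over all zeros can be differentiated through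
    one uniform quadratic estimate.

    Why 1/3 and 99: rho (z, l) < 1/3 makes 1 - |z| and 1 - |l| comparable within a factor 2, which
    leaves 3 dyadic levels; in each there are 3 angular shifts by a multiple of 2 PI and 11
    positions per shift.

    [B] is known only as a limit of partial products, so the estimate is made for these, uniformly
    in their length, and passes to the limit as a lower bound for |B|; this also excludes B(z) =
    0. *)

Lemma ball_Cmod_lt (z w : C) (e : R) : ball z e w -> Cmod (w - z) < 2 * e.
Proof.
  intros [H1 H2]. unfold ball in H1, H2; simpl in H1, H2.
  unfold AbsRing_ball, abs, minus, plus, opp in H1, H2; simpl in H1, H2.
  pose proof (Cmod_2Rmax (w - z)%C) as HM; simpl in HM.
  (* Balls of [C] are squares in the two coordinates, so the modulus costs a factor sqrt 2, rounded
     up to 2. *)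
  assert (Hs : sqrt 2 <= 2).
  { pose proof (sqrt_sqrt 2); pose proof (sqrt_pos 2). nra. }
  assert (0 < sqrt 2) by (apply sqrt_lt_R0; lra).
  assert (Hm : Rmax (Rabs (fst w + - fst z)) (Rabs (snd w + - snd z)) < e)
    by (apply Rmax_lub_lt; assumption).
  assert (0 <= Rmax (Rabs (fst w + - fst z)) (Rabs (snd w + - snd z)))
    by (eapply Rle_trans; [apply Rabs_pos | apply Rmax_l]).
  nra.
Qed.

Lemma locally_Cmod (z : C) (P : C -> Prop) (e : R) :
  0 < e -> (forall w, Cmod (w - z) < e -> P w) -> locally z P.
Proof.
  intros He HP. assert (He2 : 0 < e / 2) by lra.
  exists (mkposreal _ He2). intros w Hw. apply HP.
  apply ball_Cmod_lt in Hw. simpl in Hw. lra.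
Qed.

Lemma unit_disc_shift (z w : C) : Cmod (w - z) < 1 - Cmod z -> unit_disc w.
Proof.
  intros Hw. unfold unit_disc. replace w with (z + (w - z))%C by ring.
  eapply Rle_lt_trans; [apply Cmod_triangle | lra].
Qed.

Lemma unit_disc_open : open unit_disc.
Proof.
  intros z Hz. apply (locally_Cmod z _ (1 - Cmod z)).
  - unfold unit_disc in Hz; lra.
  - apply unit_disc_shift.
Qed.

Lemma locally_slice_x (z : C) (P : C -> Prop) :
  locally z P -> locally (Re z) (fun x => P (x, Im z)).
Proof.
  intros [e He]. exists e. intros x Hx. apply He. split; [exact Hx | apply ball_center].
Qed.

Lemma locally_slice_y (z : C) (P : C -> Prop) :
  locally z P -> locally (Im z) (fun y => P (Re z, y)).
Proof.
  intros [e He]. exists e. intros y Hy. apply He. split; [apply ball_center | exact Hy].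
Qed.

Lemma C_eta (z : C) : (Re z, Im z) = z.
Proof. destruct z; reflexivity. Qed.

(** The total partial derivatives agree with the candidates [ux] and [uy] only inside [D]; openness
    turns this into agreement near each point, so continuity carries over. *)
Lemma C1_intro (D : C -> Prop) (u ux uy : C -> R) :
  open D ->
  (forall z, D z -> is_derive (slice_x u z) (Re z) (ux z)) ->
  (forall z, D z -> is_derive (slice_y u z) (Im z) (uy z)) ->
  (forall z, D z -> continuous ux z) ->
  (forall z, D z -> continuous uy z) ->
  C1_on D u /\ (forall z, D z -> partial_x u z = ux z) /\
  (forall z, D z -> partial_y u z = uy z).
Proof.
  intros Ho Hx Hy Cx Cy.
  assert (Ex : forall z, D z -> partial_x u z = ux z)
    by (intros z Hz; apply is_derive_unique; auto).
  assert (Ey : forall z, D z -> partial_y u z = uy z)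
    by (intros z Hz; apply is_derive_unique; auto).
  split; [|split; assumption].
  intros z Hz. repeat split.
  - eexists; apply Hx; exact Hz.
  - eexists; apply Hy; exact Hz.
  - apply (continuous_ext_loc (U:=R_UniformSpace) (partial_x u) ux); [|apply Cx, Hz].
    apply (locally_open D); [exact Ho | | exact Hz]. intros w Hw; symmetry; auto.
  - apply (continuous_ext_loc (U:=R_UniformSpace) (partial_y u) uy); [|apply Cy, Hz].
    apply (locally_open D); [exact Ho | | exact Hz]. intros w Hw; symmetry; auto.
Qed.

Lemma C1_ext (D : C -> Prop) (u v : C -> R) :
  open D -> (forall z, D z -> u z = v z) -> C1_on D u ->
  C1_on D v /\ (forall z, D z -> partial_x v z = partial_x u z) /\
  (forall z, D z -> partial_y v z = partial_y u z).
Proof.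
  intros Ho Huv Hu. apply C1_intro; try assumption.
  - intros z Hz. destruct (Hu z Hz) as (H1 & _).
    apply (is_derive_ext_loc (slice_x u z)); [|apply Derive_correct, H1].
    apply (locally_slice_x z (fun w => u w = v w)).
    apply (locally_open D); auto.
  - intros z Hz. destruct (Hu z Hz) as (_ & H1 & _).
    apply (is_derive_ext_loc (slice_y u z)); [|apply Derive_correct, H1].
    apply (locally_slice_y z (fun w => u w = v w)).
    apply (locally_open D); auto.
  - intros z Hz. exact (proj1 (proj2 (proj2 (Hu z Hz)))).
  - intros z Hz. exact (proj2 (proj2 (proj2 (Hu z Hz)))).
Qed.

(** Lets the second derivatives be computed on explicit formulas [ux], [uy]: partial derivatives are
    local, so equality on the open set [D] is enough to exchange them with [partial_x u],
    [partial_y u]. *)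
Lemma harmonic_intro (D : C -> Prop) (u ux uy : C -> R) :
  open D -> C1_on D u -> C1_on D ux -> C1_on D uy ->
  (forall z, D z -> partial_x u z = ux z) ->
  (forall z, D z -> partial_y u z = uy z) ->
  (forall z, D z -> partial_x ux z + partial_y uy z = 0) ->
  harmonic_on D u.
Proof.
  intros Ho Hu Hux Huy Ex Ey HL.
  destruct (C1_ext D ux (partial_x u) Ho) as (Cx & Exx & _); trivial.
  { intros; symmetry; auto. }
  destruct (C1_ext D uy (partial_y u) Ho) as (Cy & _ & Eyy); trivial.
  { intros; symmetry; auto. }
  split; [split; [|split]; assumption|].
  intros z Hz. unfold laplacian. rewrite Exx, Eyy by assumption. auto.
Qed.

Lemma C1_lin (D : C -> Prop) (u v : C -> R) (a b : R) :
  open D -> C1_on D u -> C1_on D v ->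
  C1_on D (fun z => a * u z + b * v z) /\
  (forall z, D z ->
     partial_x (fun z => a * u z + b * v z) z = a * partial_x u z + b * partial_x v z) /\
  (forall z, D z ->
     partial_y (fun z => a * u z + b * v z) z = a * partial_y u z + b * partial_y v z).
Proof.
  intros Ho Hu Hv.
  apply (C1_intro D (fun z => a * u z + b * v z)
    (fun z => a * partial_x u z + b * partial_x v z)
    (fun z => a * partial_y u z + b * partial_y v z)); try assumption; intros z Hz;
  destruct (Hu z Hz) as (U1 & U2 & U3 & U4); destruct (Hv z Hz) as (V1 & V2 & V3 & V4).
  - apply (is_derive_plus (K := R_AbsRing) (V := R_NormedModule) (fun x => a * slice_x u z x) (fun x => b * slice_x v z x));
    apply is_derive_scal, Derive_correct; assumption.
  - apply (is_derive_plus (K := R_AbsRing) (V := R_NormedModule) (fun x => a * slice_y u z x) (fun x => b * slice_y v z x));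
    apply is_derive_scal, Derive_correct; assumption.
  - apply (continuous_plus (fun z => a * partial_x u z) (fun z => b * partial_x v z));
    apply (continuous_scal_r (K := R_AbsRing) (V := R_NormedModule)); assumption.
  - apply (continuous_plus (fun z => a * partial_y u z) (fun z => b * partial_y v z));
    apply (continuous_scal_r (K := R_AbsRing) (V := R_NormedModule)); assumption.
Qed.

Lemma harmonic_lin (D : C -> Prop) (u v : C -> R) (a b : R) :
  open D -> harmonic_on D u -> harmonic_on D v ->
  harmonic_on D (fun z => a * u z + b * v z).
Proof.
  intros Ho ((U1 & Ux & Uy) & UL) ((V1 & Vx & Vy) & VL).
  destruct (C1_lin D u v a b Ho U1 V1) as (H1 & H2 & H3).
  destruct (C1_lin D _ _ a b Ho Ux Vx) as (X1 & X2 & X3).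
  destruct (C1_lin D _ _ a b Ho Uy Vy) as (Y1 & Y2 & Y3).
  apply (harmonic_intro D _ _ _ Ho H1 X1 Y1 H2 H3).
  intros z Hz. rewrite X2, Y3 by assumption.
  pose proof (UL z Hz) as L1; pose proof (VL z Hz) as L2. unfold laplacian in L1, L2.
  transitivity (a * (partial_x (partial_x u) z + partial_y (partial_y u) z)
    + b * (partial_x (partial_x v) z + partial_y (partial_y v) z)); [ring|].
  rewrite L1, L2; ring.
Qed.

(** Total differentiability comes from the x-derivative existing nearby and being continuous at the
    point, together with the y-derivative at the point itself. *)
Lemma C1_filterdiff (D : C -> Prop) (u : C -> R) (x y : R) :
  open D -> C1_on D u -> D (x, y) ->
  filterdiff (fun p : R * R => u (fst p, snd p)) (locally (x, y))
    (fun p : R * R => fst p * partial_x u (x, y) + snd p * partial_y u (x, y)).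
Proof.
  intros Ho Hu Hz.
  apply (is_derive_filterdiff (fun a b => u (a, b)) x y
    (fun a b => partial_x u (a, b)) (partial_y u (x, y))).
  - apply (locally_open D); [exact Ho | | exact Hz].
    intros [a b] Hab. simpl. destruct (Hu _ Hab) as (H1 & _). apply Derive_correct in H1. exact H1.
  - destruct (Hu _ Hz) as (_ & H1 & _). apply Derive_correct in H1. exact H1.
  - destruct (Hu _ Hz) as (_ & _ & H1 & _).
    eapply continuous_ext; [|exact H1]. intros [a b]; reflexivity.
Qed.

Lemma C1_continuous (D : C -> Prop) (u : C -> R) (z : C) :
  open D -> C1_on D u -> D z -> continuous u z.
Proof.
  intros Ho Hu Hz. destruct z as [x y].
  apply (continuous_ext (fun p : R * R => u (fst p, snd p))).
  { intros [a b]; reflexivity. }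
  apply (filterdiff_continuous (K := R_AbsRing) (fun p : R * R => u (fst p, snd p)) (x, y)).
  eexists. apply (C1_filterdiff D); assumption.
Qed.

Lemma C1_chain (D : C -> Prop) (u : C -> R) (x y : R -> R) (s dx dy : R) :
  open D -> C1_on D u -> D (x s, y s) -> is_derive x s dx -> is_derive y s dy ->
  is_derive (fun s => u (x s, y s)) s
    (partial_x u (x s, y s) * dx + partial_y u (x s, y s) * dy).
Proof.
  intros Ho Hu Hz Hx Hy. apply is_derive_Reals.
  apply (derivable_pt_lim_comp_2d (fun a b => u (a, b)) x y).
  - apply filterdiff_differentiable_pt_lim. apply (C1_filterdiff D); assumption.
  - apply is_derive_Reals; exact Hx.
  - apply is_derive_Reals; exact Hy.
Qed.

(** * Weighted circular means *)

Definition circ (c : C) (r t : R) : C := (Re c + r * cos t, Im c + r * sin t).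

Definition circle_int (c : C) (g : C -> R) (k : R -> R) (r : R) : R :=
  RInt (fun t => g (circ c r t) * k t) 0 (2 * PI).

Lemma Cmod_polar (r t : R) : Cmod (polar r t) = Rabs r.
Proof.
  unfold polar, Cmod; simpl.
  replace (r * cos t * (r * cos t * 1) + r * sin t * (r * sin t * 1))
    with (r² * ((sin t)² + (cos t)²)) by (unfold Rsqr; ring).
  rewrite sin2_cos2, Rmult_1_r. apply sqrt_Rsqr_abs.
Qed.

Lemma circ_disc (c : C) (r t : R) : Rabs r < 1 - Cmod c -> unit_disc (circ c r t).
Proof.
  intros Hr. apply (unit_disc_shift c).
  replace (circ c r t - c)%C with (polar r t).
  - rewrite Cmod_polar; exact Hr.
  - unfold circ, polar. destruct c as [a b]. unfold Cminus, Cplus, Copp; simpl.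
    f_equal; ring.
Qed.

Lemma continuous_circ (c : C) (g : C -> R) (r t : R) :
  continuous g (circ c r t) ->
  continuous (fun p : R * R => g (circ c (fst p) (snd p))) (r, t).
Proof.
  intros Hg.
  apply (continuous_comp_2 (fun p : R * R => Re c + fst p * cos (snd p))
    (fun p : R * R => Im c + fst p * sin (snd p)) (fun a b => g (a, b))).
  - apply (continuous_plus (fun _ => Re c) (fun p : R * R => fst p * cos (snd p))); [apply continuous_const|].
    apply (continuous_mult (fun p : R * R => fst p) (fun p : R * R => cos (snd p))).
    + apply continuous_fst.
    + apply (continuous_comp (fun p : R * R => snd p) cos); [apply continuous_snd | apply continuous_cos].
  - apply (continuous_plus (fun _ => Im c) (fun p : R * R => fst p * sin (snd p))); [apply continuous_const|].
    apply (continuous_mult (fun p : R * R => fst p) (fun p : R * R => sin (snd p))).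
    + apply continuous_fst.
    + apply (continuous_comp (fun p : R * R => snd p) sin); [apply continuous_snd | apply continuous_sin].
  - eapply continuous_ext; [|exact Hg]. intros [a b]; reflexivity.
Qed.

Lemma continuous_circ_t (c : C) (g : C -> R) (r t : R) :
  continuous g (circ c r t) -> continuous (fun t => g (circ c r t)) t.
Proof.
  intros Hg.
  apply (continuous_comp_2 (fun _ => r) (fun t => t) (fun a b => g (circ c a b))).
  - apply continuous_const.
  - apply continuous_id.
  - apply continuous_circ, Hg.
Qed.

Definition cont_disc (g : C -> R) := forall z, unit_disc z -> continuous g z.
Definition cont_R (k : R -> R) := forall t : R, continuous k t.

Lemma is_RInt_circle (c : C) (g : C -> R) (k : R -> R) (r : R) :
  cont_disc g -> cont_R k -> Rabs r < 1 - Cmod c ->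
  is_RInt (fun t => g (circ c r t) * k t) 0 (2 * PI) (circle_int c g k r).
Proof.
  intros Hg Hk Hr. apply (RInt_correct (V := R_CompleteNormedModule)).
  apply (ex_RInt_continuous (V := R_CompleteNormedModule)). intros t _.
  apply (continuous_mult (fun t => g (circ c r t)) k); [|apply Hk].
  apply continuous_circ_t, Hg, circ_disc, Hr.
Qed.

Lemma is_derive_circ_r (c : C) (u : C -> R) (r t : R) :
  C1_on unit_disc u -> Rabs r < 1 - Cmod c ->
  is_derive (fun r => u (circ c r t)) r
    (partial_x u (circ c r t) * cos t + partial_y u (circ c r t) * sin t).
Proof.
  intros Hu Hr. unfold circ.
  apply (C1_chain unit_disc u (fun r => Re c + r * cos t) (fun r => Im c + r * sin t)
    r (cos t) (sin t)); [apply unit_disc_open | exact Hu | apply circ_disc, Hr | |];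
  auto_derive; trivial; ring.
Qed.

Lemma is_derive_circ_t (c : C) (u : C -> R) (r t : R) :
  C1_on unit_disc u -> Rabs r < 1 - Cmod c ->
  is_derive (fun t => u (circ c r t)) t
    (partial_x u (circ c r t) * (- r * sin t) + partial_y u (circ c r t) * (r * cos t)).
Proof.
  intros Hu Hr. unfold circ.
  apply (C1_chain unit_disc u (fun t => Re c + r * cos t) (fun t => Im c + r * sin t)
    t (- r * sin t) (r * cos t)); [apply unit_disc_open | exact Hu | apply circ_disc, Hr | |];
  auto_derive; trivial; ring.
Qed.

Lemma C1_cont (u : C -> R) : C1_on unit_disc u ->
  cont_disc u /\ cont_disc (partial_x u) /\ cont_disc (partial_y u).
Proof.
  intros Hu. split; [|split]; intros z Hz.
  - apply (C1_continuous unit_disc); trivial. apply unit_disc_open.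
  - exact (proj1 (proj2 (proj2 (Hu z Hz)))).
  - exact (proj2 (proj2 (proj2 (Hu z Hz)))).
Qed.

Lemma locally_Rabs_lt (r e : R) : Rabs r < e -> locally r (fun s => Rabs s < e).
Proof.
  intros Hr. assert (Hd : 0 < e - Rabs r) by lra.
  exists (mkposreal _ Hd). intros s Hs.
  unfold ball in Hs; simpl in Hs. unfold AbsRing_ball, abs, minus, plus, opp in Hs; simpl in Hs.
  pose proof (Rabs_triang r (s + - r)). assert (Hrs : r + (s + - r) = (s : R)) by (simpl in *; lra).
  rewrite Hrs in H. lra.
Qed.

Lemma is_derive_circle_int (c : C) (u : C -> R) (k : R -> R) (r : R) :
  C1_on unit_disc u -> cont_R k -> Rabs r < 1 - Cmod c ->
  is_derive (circle_int c u k) r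
    (circle_int c (partial_x u) (fun t => cos t * k t) r +
     circle_int c (partial_y u) (fun t => sin t * k t) r).
Proof.
  intros Hu Hk Hr. destruct (C1_cont u Hu) as (C0 & Cx & Cy).
  set (d := fun r t => (partial_x u (circ c r t) * cos t + partial_y u (circ c r t) * sin t) * k t : R).
  assert (Hd : forall s t, Rabs s < 1 - Cmod c -> is_derive (fun r => u (circ c r t) * k t) s (d s t)).
  { intros s t Hs. unfold d.
    apply (is_derive_ext (fun r => k t * u (circ c r t))); [intros; apply Rmult_comm|].
    rewrite (Rmult_comm (_ + _)). apply is_derive_scal. apply is_derive_circ_r; assumption. }
  assert (HI : RInt (fun t => Derive (fun s => u (circ c s t) * k t) r) 0 (2 * PI)
    = circle_int c (partial_x u) (fun t => cos t * k t) r +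
      circle_int c (partial_y u) (fun t => sin t * k t) r).
  { apply is_RInt_unique.
    eapply is_RInt_ext; [|apply (is_RInt_plus (V := R_NormedModule)); apply is_RInt_circle; trivial].
    - intros t _. etransitivity; [|symmetry; exact (is_derive_unique _ _ _ (Hd r t Hr))].
      unfold d, plus; simpl. ring.
    - intros t. apply (continuous_mult cos k); [apply continuous_cos | apply Hk].
    - intros t. apply (continuous_mult sin k); [apply continuous_sin | apply Hk]. }
  rewrite <- HI. unfold circle_int.
  apply (is_derive_RInt_param (fun r t => u (circ c r t) * k t)).
  - generalize (locally_Rabs_lt _ _ Hr). apply filter_imp. intros s Hs t _.
    eexists. apply Hd, Hs.
  - intros t _. apply continuity_2d_pt_ext_loc with d.
    + destruct (locally_Rabs_lt _ _ Hr) as [e He]. exists e. intros s t' Hs _.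
      symmetry. apply is_derive_unique, Hd, He. exact Hs.
    + apply continuity_2d_pt_filterlim.
      apply (continuous_mult (fun p : R * R => partial_x u (circ c (fst p) (snd p)) * cos (snd p)
        + partial_y u (circ c (fst p) (snd p)) * sin (snd p)) (fun p => k (snd p)) (r, t)).
      2: { apply (continuous_comp (fun p : R * R => snd p) k); [apply continuous_snd | apply Hk]. }
      apply (continuous_plus (fun p : R * R => partial_x u (circ c (fst p) (snd p)) * cos (snd p))
        (fun p => partial_y u (circ c (fst p) (snd p)) * sin (snd p))).
      * apply (continuous_mult (fun p : R * R => partial_x u (circ c (fst p) (snd p))) (fun p => cos (snd p))).
        -- apply continuous_circ, Cx, circ_disc, Hr.
        -- apply (continuous_comp (fun p : R * R => snd p) cos); [apply continuous_snd | apply continuous_cos].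
      * apply (continuous_mult (fun p : R * R => partial_y u (circ c (fst p) (snd p))) (fun p => sin (snd p))).
        -- apply continuous_circ, Cy, circ_disc, Hr.
        -- apply (continuous_comp (fun p : R * R => snd p) sin); [apply continuous_snd | apply continuous_sin].
  - generalize (locally_Rabs_lt _ _ Hr). apply filter_imp. intros s Hs.
    eexists. apply is_RInt_circle; assumption.
Qed.

(** A linear combination of weighted integrands is kept as a list of (coefficient, function,
    weight). One pointwise identity, saying that the combination is the t-derivative of a periodic
    function, then yields a linear relation between the [circle_int]s. *)
Fixpoint trig_sum (c : C) (L : list (R * (C -> R) * (R -> R))) (r t : R) : R :=
  match L with
  | [] => 0
  | (a, g, w) :: L' => a * (g (circ c r t) * w t) + trig_sum c L' r t
  end.

Fixpoint trig_int (c : C) (L : list (R * (C -> R) * (R -> R))) (r : R) : R :=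
  match L with
  | [] => 0
  | (a, g, w) :: L' => a * circle_int c g w r + trig_int c L' r
  end.

Definition trig_ok (L : list (R * (C -> R) * (R -> R))) : Prop :=
  List.Forall (fun p => cont_disc (snd (fst p)) /\ cont_R (snd p)) L.

Lemma trig_sum_int (c : C) L (r : R) :
  trig_ok L -> Rabs r < 1 - Cmod c ->
  is_RInt (trig_sum c L r) 0 (2 * PI) (trig_int c L r).
Proof.
  intros HL Hr. induction HL as [|[[a g] w] L [Hg Hw] HL IH]; simpl.
  - replace 0 with (scal (2 * PI - 0) 0) at 2 by (unfold scal; simpl; unfold mult; simpl; ring).
    apply (is_RInt_const (V := R_NormedModule)).
  - apply (is_RInt_plus (V := R_NormedModule)); [|exact IH].
    apply (is_RInt_scal (V := R_NormedModule)). apply is_RInt_circle; assumption.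
Qed.

Lemma trig_sum_continuous (c : C) L (r t : R) :
  trig_ok L -> Rabs r < 1 - Cmod c -> continuous (trig_sum c L r) t.
Proof.
  intros HL Hr. induction HL as [|[[a g] w] L [Hg Hw] HL IH]; simpl.
  - apply continuous_const.
  - apply (continuous_plus (fun t => a * (g (circ c r t) * w t)) (trig_sum c L r)); [|exact IH].
    apply (continuous_scal_r (K := R_AbsRing) (V := R_NormedModule)).
    apply (continuous_mult (fun t => g (circ c r t)) w); [|apply Hw].
    apply continuous_circ_t, Hg, circ_disc, Hr.
Qed.

Lemma trig_int_exact (c : C) L (r : R) (F : R -> R) :
  trig_ok L -> Rabs r < 1 - Cmod c ->
  (forall t, is_derive F t (trig_sum c L r t)) -> F (2 * PI) = F 0 ->
  trig_int c L r = 0.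
Proof.
  intros HL Hr HF Hper.
  assert (H1 : is_RInt (trig_sum c L r) 0 (2 * PI) (minus (F (2 * PI)) (F 0))).
  { apply (is_RInt_derive (V := R_CompleteNormedModule)).
    - intros t _. apply HF.
    - intros t _. apply trig_sum_continuous; assumption. }
  pose proof (is_RInt_unique _ _ _ _ H1) as H2.
  rewrite (is_RInt_unique _ _ _ _ (trig_sum_int c L r HL Hr)) in H2.
  rewrite H2. unfold minus, plus, opp; simpl. lra.
Qed.

Lemma is_derive_circ_weight (c : C) (g : C -> R) (w : R -> R) (r t dw : R) :
  C1_on unit_disc g -> Rabs r < 1 - Cmod c -> is_derive w t dw ->
  is_derive (fun t => g (circ c r t) * w t) t
    ((partial_x g (circ c r t) * (- r * sin t) + partial_y g (circ c r t) * (r * cos t)) * w t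
     + g (circ c r t) * dw).
Proof.
  intros Hg Hr Hw.
  apply (is_derive_mult (fun t => g (circ c r t)) w).
  - apply is_derive_circ_t; assumption.
  - exact Hw.
  - intros; apply Rmult_comm.
Qed.

Lemma cont_R_mult (f g : R -> R) : cont_R f -> cont_R g -> cont_R (fun t => f t * g t).
Proof. intros Hf Hg t. apply (continuous_mult f g); auto. Qed.

Lemma is_derive_cont_R (f f' : R -> R) : (forall t, is_derive f t (f' t)) -> cont_R f.
Proof. intros Hf t. apply (ex_derive_continuous (K := R_AbsRing) (V := R_NormedModule)). eexists; apply Hf. Qed.

Lemma ex_derive_cont_R (f : R -> R) : (forall t, ex_derive f t) -> cont_R f.
Proof. intros Hf t. apply (ex_derive_continuous (K := R_AbsRing) (V := R_NormedModule)), Hf. Qed.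

Lemma cont_R_cos : cont_R cos.
Proof. intros t; apply continuous_cos. Qed.
Lemma cont_R_sin : cont_R sin.
Proof. intros t; apply continuous_sin. Qed.

Ltac ok_tac := repeat apply List.Forall_cons; [.. | apply List.Forall_nil]; split; simpl;
  repeat first [match goal with
    | H : cont_disc ?g |- cont_disc ?g => exact H
    | H : cont_R ?k |- cont_R ?k => exact H end
    | apply cont_R_cos | apply cont_R_sin | apply cont_R_mult].

(* Integrating the [t]-derivative of [(- u_x sin t + u_y cos t) k]; the second
   order terms are reduced with [u_xx + u_yy = 0]. *)
Lemma flux_identity (c : C) (u : C -> R) (k k1 : R -> R) (r : R) :
  harmonic_on unit_disc u -> (forall t, is_derive k t (k1 t)) -> cont_R k1 ->
  k (2 * PI) = k 0 -> Rabs r < 1 - Cmod c ->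
  let ux := partial_x u in let uy := partial_y u in
  circle_int c ux (fun t => cos t * k t) r + circle_int c uy (fun t => sin t * k t) r
  + r * ((circle_int c (partial_x ux) (fun t => cos t * (cos t * k t)) r
          + circle_int c (partial_y ux) (fun t => sin t * (cos t * k t)) r)
         + (circle_int c (partial_x uy) (fun t => cos t * (sin t * k t)) r
          + circle_int c (partial_y uy) (fun t => sin t * (sin t * k t)) r))
  = circle_int c uy (fun t => cos t * k1 t) r - circle_int c ux (fun t => sin t * k1 t) r.
Proof.
  intros ((Hu & Hux & Huy) & HL) Hk Hk1 Hper Hr ux uy.
  pose proof (is_derive_cont_R _ _ Hk) as Ck.
  destruct (C1_cont _ Hu) as (_ & C1 & C2).
  destruct (C1_cont _ Hux) as (_ & C3 & C4).
  destruct (C1_cont _ Huy) as (_ & C5 & C6).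
  assert (E : trig_int c
    [ (-1, ux, fun t => cos t * k t); (-1, uy, fun t => sin t * k t);
      (- r, partial_x ux, fun t => cos t * (cos t * k t));
      (- r, partial_y ux, fun t => sin t * (cos t * k t));
      (- r, partial_x uy, fun t => cos t * (sin t * k t));
      (- r, partial_y uy, fun t => sin t * (sin t * k t));
      (1, uy, fun t => cos t * k1 t); (-1, ux, fun t => sin t * k1 t) ] r = 0).
  { apply (trig_int_exact c _ r (fun t => ux (circ c r t) * (- (sin t) * k t)
      + uy (circ c r t) * (cos t * k t))).
    - ok_tac.
    - exact Hr.
    - intros t.
      assert (D1 : is_derive (fun t => - sin t * k t) t (- cos t * k t + - sin t * k1 t)).
      { apply (is_derive_mult (fun t => - sin t) k); [|apply Hk|intros; apply Rmult_comm].
        auto_derive; trivial; ring. }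
      assert (D2 : is_derive (fun t => cos t * k t) t (- sin t * k t + cos t * k1 t)).
      { apply (is_derive_mult cos k); [|apply Hk|intros; apply Rmult_comm].
        auto_derive; trivial; ring. }
      pose proof (is_derive_plus _ _ _ _ _ (is_derive_circ_weight c ux _ r t _ Hux Hr D1)
        (is_derive_circ_weight c uy _ r t _ Huy Hr D2)) as D3.
      simpl. eapply (eq_ind _ (fun l => is_derive _ t l)); [exact D3|].
      unfold plus; simpl.
      pose proof (HL (circ c r t) (circ_disc c r t Hr)) as Lap.
      unfold laplacian in Lap. fold ux uy in Lap.
      apply Rminus_diag_uniq.
      match goal with |- ?l = 0 => replace l with
        (r * k t * ((sin t)² + (cos t)²) * (partial_x ux (circ c r t) + partial_y uy (circ c r t)))
        by (unfold Rsqr; ring) end.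
      rewrite Lap; ring.
    - rewrite Hper, sin_2PI, cos_2PI, sin_0, cos_0.
      unfold circ. rewrite sin_2PI, cos_2PI, sin_0, cos_0. reflexivity. }
  simpl in E. lra.
Qed.

(** Integration by parts in t: r (u_y cos t - u_x sin t) is the t-derivative of u along the circle,
    and periodicity removes the boundary term. *)
Lemma weight_identity (c : C) (u : C -> R) (k1 k2 : R -> R) (r : R) :
  C1_on unit_disc u -> (forall t, is_derive k1 t (k2 t)) -> cont_R k2 ->
  k1 (2 * PI) = k1 0 -> Rabs r < 1 - Cmod c ->
  r * (circle_int c (partial_y u) (fun t => cos t * k1 t) r
       - circle_int c (partial_x u) (fun t => sin t * k1 t) r)
  = - circle_int c u k2 r.
Proof.
  intros Hu Hk Hk2 Hper Hr.
  pose proof (is_derive_cont_R _ _ Hk) as Ck.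
  destruct (C1_cont _ Hu) as (C0 & C1 & C2).
  assert (E : trig_int c
    [ (r, partial_y u, fun t => cos t * k1 t); (- r, partial_x u, fun t => sin t * k1 t);
      (1, u, k2) ] r = 0).
  { apply (trig_int_exact c _ r (fun t => u (circ c r t) * k1 t)).
    - ok_tac.
    - exact Hr.
    - intros t. simpl. eapply (eq_ind _ (fun l => is_derive _ t l));
        [exact (is_derive_circ_weight c u _ r t _ Hu Hr (Hk t))|]. simpl; ring.
    - rewrite Hper. unfold circ. rewrite sin_2PI, cos_2PI, sin_0, cos_0. reflexivity. }
  simpl in E. lra.
Qed.

Lemma circle_int_ext (c : C) (g : C -> R) (k1 k2 : R -> R) (r : R) :
  (forall t, k1 t = k2 t) -> circle_int c g k1 r = circle_int c g k2 r.
Proof. intros Hk. apply RInt_ext. intros t _. rewrite Hk; reflexivity. Qed.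

Lemma circle_int_0 (c : C) (g : C -> R) (r : R) : circle_int c g (fun _ => 0) r = 0.
Proof.
  unfold circle_int. rewrite (RInt_ext _ (fun _ => 0)) by (intros; apply Rmult_0_r).
  rewrite RInt_const. unfold scal; simpl; unfold mult; simpl; ring.
Qed.

Lemma circle_int_center (c : C) (g : C -> R) (k : R -> R) (l : R) :
  is_RInt k 0 (2 * PI) l -> circle_int c g k 0 = g c * l.
Proof.
  intros Hk. apply is_RInt_unique.
  apply (is_RInt_ext (fun t => scal (g c) (k t))).
  - intros t _. unfold circ. rewrite !Rmult_0_l, !Rplus_0_r, C_eta. reflexivity.
  - apply (is_RInt_scal (V := R_NormedModule)), Hk.
Qed.

(** * Radial differential equation for circular means *)

Definition radial_int (c : C) (u : C -> R) (k : R -> R) (r : R) : R :=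
  circle_int c (partial_x u) (fun t => cos t * k t) r
  + circle_int c (partial_y u) (fun t => sin t * k t) r.

(** With W = [circle_int c u k], [radial_int] is W', and the last equation is r (r W')' = -
    (integral of u against k''), the polar Laplace equation tested against k. The equation before
    multiplication by r is kept as well: for constant k its right side vanishes, at r = 0 too. *)
Lemma radial_equation (c : C) (u : C -> R) (k k1 k2 : R -> R) (r : R) :
  harmonic_on unit_disc u ->
  (forall t, is_derive k t (k1 t)) -> (forall t, is_derive k1 t (k2 t)) -> cont_R k2 ->
  k (2 * PI) = k 0 -> k1 (2 * PI) = k1 0 -> Rabs r < 1 - Cmod c ->
  exists E' : R, is_derive (radial_int c u k) r E' /\
    radial_int c u k r + r * E' =
      circle_int c (partial_y u) (fun t => cos t * k1 t) r
      - circle_int c (partial_x u) (fun t => sin t * k1 t) r /\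
    r * (radial_int c u k r + r * E') = - circle_int c u k2 r.
Proof.
  intros Hu Hk Hk1 Ck2 Hp Hp1 Hr.
  pose proof Hu as ((H1 & Hx & Hy) & _).
  pose proof (is_derive_cont_R _ _ Hk) as Ck.
  pose proof (is_derive_cont_R _ _ Hk1) as Ck1.
  pose proof (flux_identity c u k k1 r Hu Hk Ck1 Hp Hr) as F. cbv zeta in F.
  eexists. split; [|split].
  - apply (is_derive_plus (K := R_AbsRing) (V := R_NormedModule));
      apply is_derive_circle_int; trivial; apply cont_R_mult; trivial;
      [apply cont_R_cos | apply cont_R_sin].
  - exact F.
  - rewrite <- (weight_identity c u k1 k2 r H1 Hk1 Ck2 Hp1 Hr). f_equal. exact F.
Qed.

Lemma const_on_right (f : R -> R) (r : R) :
  0 <= r -> (forall s, 0 < s < r -> is_derive f s 0) ->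
  (forall s, 0 <= s <= r -> continuity_pt f s) -> f r = f 0.
Proof.
  intros Hr Hd Hc. destruct (MVT_gen f 0 r (fun _ => 0)) as (x & _ & Hx).
  - rewrite Rmin_left, Rmax_right by lra. exact Hd.
  - rewrite Rmin_left, Rmax_right by lra. exact Hc.
  - lra.
Qed.

Lemma is_derive_continuity_pt (f : R -> R) (x l : R) : is_derive f x l -> continuity_pt f x.
Proof.
  intros Hf. apply derivable_continuous_pt. exists l. apply is_derive_Reals, Hf.
Qed.

(** For k = 1 the equation reads (r W')' = 0. Hence r W' keeps its value 0 from the centre, W is
    constant, and at radius 0 it equals 2 PI u(c). *)
Lemma mean_value (c : C) (u : C -> R) (r : R) :
  harmonic_on unit_disc u -> 0 <= r < 1 - Cmod c ->
  circle_int c u (fun _ => 1) r = 2 * PI * u c.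
Proof.
  intros Hu Hr. set (E := radial_int c u (fun _ => 1)).
  assert (HR : forall s, 0 <= s <= r -> exists E', is_derive E s E' /\ E s + s * E' = 0).
  { intros s Hs. assert (Hs' : Rabs s < 1 - Cmod c) by (rewrite Rabs_right; lra).
    destruct (radial_equation c u (fun _ => 1) (fun _ => 0) (fun _ => 0) s) as (E' & D & Eq & _);
      trivial; try (intros t; auto_derive; trivial; fail).
    { intros t; apply continuous_const. }
    exists E'. split; [exact D|]. unfold E. rewrite Eq.
    rewrite (circle_int_ext c (partial_y u) _ (fun _ => 0)) by (intros; ring).
    rewrite (circle_int_ext c (partial_x u) _ (fun _ => 0)) by (intros; ring).
    rewrite !circle_int_0. ring. }
  assert (HD : forall s, 0 <= s <= r -> is_derive (fun s => s * E s) s 0).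
  { intros s Hs. destruct (HR s Hs) as (E' & D & Eq).
    rewrite <- Eq. replace (E s + s * E') with (1 * E s + s * E') by ring.
    apply (is_derive_mult (fun s => s) E); [apply (is_derive_id s) | exact D | intros; apply Rmult_comm]. }
  assert (E0 : forall s, 0 < s <= r -> E s = 0).
  { intros s Hs. assert (H0 : s * E s = 0 * E 0).
    { apply (const_on_right (fun s => s * E s)); [lra | |].
      - intros x Hx; apply HD; lra.
      - intros x Hx; eapply is_derive_continuity_pt; apply HD; lra. }
    apply (Rmult_eq_reg_l s); lra. }
  assert (HW : forall s, 0 <= s <= r -> is_derive (circle_int c u (fun _ => 1)) s (E s)).
  { intros s Hs. apply is_derive_circle_int; [apply Hu | intros t; apply continuous_const|].
    rewrite Rabs_right; lra. }
  rewrite (const_on_right (circle_int c u (fun _ => 1)) r).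
  - rewrite (circle_int_center c u _ (2 * PI)); [ring|].
    replace (2 * PI) with (scal (2 * PI - 0) 1) at 2 by (unfold scal; simpl; unfold mult; simpl; ring).
    apply (is_RInt_const (V := R_NormedModule)).
  - lra.
  - intros s Hs. rewrite <- (E0 s) by lra. apply HW; lra.
  - intros s Hs. eapply is_derive_continuity_pt, HW, Hs.
Qed.

(** Here k'' = - k, so W solves the Euler equation r (r W')' = W with solutions r and 1/r.
    Smoothness at the centre leaves only r, with slope W'(0). *)
Lemma first_moment (c : C) (u : C -> R) (a b r : R) :
  harmonic_on unit_disc u -> 0 <= r < 1 - Cmod c ->
  circle_int c u (fun t => a * cos t + b * sin t) r
  = PI * r * (a * partial_x u c + b * partial_y u c).
Proof.
  intros Hu Hr. set (k := fun t => a * cos t + b * sin t).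
  set (E := radial_int c u k). set (W := circle_int c u k).
  assert (Dk : forall t, is_derive k t (- a * sin t + b * cos t))
    by (intros t; unfold k; auto_derive; trivial; ring).
  assert (HR : forall s, 0 <= s <= r -> exists E', is_derive E s E' /\ s * (E s + s * E') = W s).
  { intros s Hs. assert (Hs' : Rabs s < 1 - Cmod c) by (rewrite Rabs_right; lra).
    destruct (radial_equation c u k (fun t => - a * sin t + b * cos t)
      (fun t => (- a) * cos t + (- b) * sin t) s) as (E' & D & _ & Eq); trivial.
    - intros t; auto_derive; trivial; ring.
    - apply ex_derive_cont_R. intros t. auto_derive; trivial.
    - unfold k. cbv beta. rewrite sin_2PI, cos_2PI, sin_0, cos_0; reflexivity.
    - cbv beta. rewrite sin_2PI, cos_2PI, sin_0, cos_0; reflexivity.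
    - exists E'. split; [exact D|]. unfold E. rewrite Eq. unfold W.
      unfold circle_int.
      rewrite <- (RInt_opp (V := R_CompleteNormedModule)).
      + apply RInt_ext. intros t _. unfold opp, k; simpl. ring.
      + eexists. apply is_RInt_circle; [|  | exact Hs'].
        * apply C1_cont, Hu.
        * apply ex_derive_cont_R. intros t. auto_derive; trivial. }
  assert (HW : forall s, 0 <= s <= r -> is_derive W s (E s)).
  { intros s Hs. apply is_derive_circle_int; [apply Hu | eapply is_derive_cont_R, Dk |].
    rewrite Rabs_right; lra. }
  (* The quantity s (s W' - W) measures the coefficient of the solution 1/s; it is constant and
     vanishes at s = 0. *)
  assert (HD : forall s, 0 <= s <= r -> is_derive (fun s => s * (s * E s - W s)) s 0).
  { intros s Hs. destruct (HR s Hs) as (E' & D & Eq). pose proof (HW s Hs) as D2.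
    assert (D3 : is_derive (fun s => s * E s - W s) s ((1 * E s + s * E') - E s)).
    { apply (is_derive_minus (K := R_AbsRing) (V := R_NormedModule) (fun s => s * E s) W); [|exact D2].
      apply (is_derive_mult (fun s => s) E); [apply (is_derive_id s) | exact D | intros; apply Rmult_comm]. }
    replace 0 with (1 * (s * E s - W s) + s * ((1 * E s + s * E') - E s)) by lra.
    apply (is_derive_mult (fun s => s) (fun s => s * E s - W s)); [apply (is_derive_id s) | exact D3 | intros; apply Rmult_comm]. }
  assert (EW : forall s, 0 < s <= r -> s * E s = W s).
  { intros s Hs. assert (H0 : s * (s * E s - W s) = 0 * (0 * E 0 - W 0)).
    { apply (const_on_right (fun s => s * (s * E s - W s))); [lra | |].
      - intros x Hx; apply HD; lra.
      - intros x Hx; eapply is_derive_continuity_pt; apply HD; lra. }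
    apply Rminus_diag_uniq. apply (Rmult_eq_reg_l s); lra. }
  (* Inserting s E = W into the equation leaves s^2 E' = 0, so E is constant. *)
  assert (E0 : E r = E 0).
  { apply const_on_right; [lra | |].
    - intros s Hs. destruct (HR s) as (E' & D & Eq); [lra|].
      replace 0 with E'; [exact D|]. specialize (EW s).
      apply (Rmult_eq_reg_l (s * s)); nra.
    - intros s Hs. destruct (HR s Hs) as (E' & D & _).
      exact (is_derive_continuity_pt _ _ _ D). }
  assert (I1 : is_RInt (fun t => cos t * k t) 0 (2 * PI) (a * PI)).
  { pose proof (is_RInt_derive (V := R_CompleteNormedModule)
      (fun t => a * (t + sin t * cos t) / 2 + b * (sin t * sin t) / 2) (fun t => cos t * k t) 0 (2 * PI)) as HI.
    eapply (eq_ind _ (fun l => is_RInt _ 0 (2 * PI) l)).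
    - apply HI; intros t _.
      + unfold k. auto_derive; trivial. pose proof (sin2_cos2 t) as SC. unfold Rsqr in SC.
        apply Rminus_diag_uniq.
        match goal with |- ?l = 0 => replace l with
          (a / 2 * (1 - (sin t * sin t + cos t * cos t))) by field end.
        rewrite SC; ring.
      + apply cont_R_mult; [apply cont_R_cos | eapply is_derive_cont_R, Dk].
    - unfold minus, plus, opp; simpl. rewrite sin_2PI, cos_2PI, sin_0, cos_0. field. }
  assert (I2 : is_RInt (fun t => sin t * k t) 0 (2 * PI) (b * PI)).
  { pose proof (is_RInt_derive (V := R_CompleteNormedModule)
      (fun t => b * (t - sin t * cos t) / 2 + a * (sin t * sin t) / 2) (fun t => sin t * k t) 0 (2 * PI)) as HI.
    eapply (eq_ind _ (fun l => is_RInt _ 0 (2 * PI) l)).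
    - apply HI; intros t _.
      + unfold k. auto_derive; trivial. pose proof (sin2_cos2 t) as SC. unfold Rsqr in SC.
        apply Rminus_diag_uniq.
        match goal with |- ?l = 0 => replace l with
          (b / 2 * (1 - (sin t * sin t + cos t * cos t))) by field end.
        rewrite SC; ring.
      + apply cont_R_mult; [apply cont_R_sin | eapply is_derive_cont_R, Dk].
    - unfold minus, plus, opp; simpl. rewrite sin_2PI, cos_2PI, sin_0, cos_0. field. }
  assert (Ec : E 0 = PI * (a * partial_x u c + b * partial_y u c)).
  { unfold E, radial_int.
    rewrite (circle_int_center c _ _ _ I1), (circle_int_center c _ _ _ I2). ring. }
  (* [EW] is available only for positive radii; at radius 0 the moment vanishes because k has mean
     zero. *)
  destruct (Req_dec r 0) as [->|Hr0].
  - assert (I3 : is_RInt k 0 (2 * PI) 0).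
    { eapply (eq_ind _ (fun l => is_RInt _ 0 (2 * PI) l)).
      - apply (is_RInt_derive (V := R_CompleteNormedModule) (fun t => a * sin t - b * cos t)); intros t _.
        + unfold k. auto_derive; trivial; ring.
        + eapply is_derive_cont_R, Dk.
      - unfold minus, plus, opp; simpl. rewrite sin_2PI, cos_2PI, sin_0, cos_0. ring. }
    unfold W. rewrite (circle_int_center c _ _ _ I3). ring.
  - rewrite <- EW by lra. rewrite E0, Ec. ring.
Qed.

(** * Gradient bound for positive harmonic functions *)

Lemma Har_plus_gradient (u : C -> R) (c : C) (a b : R) :
  Har_plus u -> unit_disc c -> a * a + b * b <= 1 ->
  Rabs (a * partial_x u c + b * partial_y u c) <= 4 / (1 - Cmod c) * u c.
Proof.
  intros [Hu Hpos] Hc. unfold unit_disc in Hc.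
  assert (Hd : 0 < 1 - Cmod c) by lra.
  assert (Key : forall a b, a * a + b * b <= 1 ->
    - (a * partial_x u c + b * partial_y u c) <= 4 / (1 - Cmod c) * u c).
  (* The nonnegative mean gives 2 u(c) + r (a u_x + b u_y) >= 0; at half the distance to the unit
     circle, 2/r is the constant 4 / (1 - |c|). *)
  { clear a b. intros a b Hab. set (r := (1 - Cmod c) / 2).
    assert (Hr : 0 <= r < 1 - Cmod c) by (unfold r; lra).
    assert (Hr' : Rabs r < 1 - Cmod c) by (rewrite Rabs_right; lra).
    pose proof (mean_value c u r Hu Hr) as M. pose proof (first_moment c u a b r Hu Hr) as F.
    assert (Cu : cont_disc u) by apply C1_cont, Hu.
    assert (Ck : cont_R (fun t => a * cos t + b * sin t))
      by (apply ex_derive_cont_R; intros t; auto_derive; trivial).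
    assert (C1k : cont_R (fun _ => 1)) by (intros t; apply continuous_const).
    pose proof (is_RInt_plus _ _ _ _ _ _ (is_RInt_circle c u _ r Cu C1k Hr')
      (is_RInt_circle c u _ r Cu Ck Hr')) as HI.
    rewrite M, F in HI.
    assert (Hge : 0 <= 2 * PI * u c + PI * r * (a * partial_x u c + b * partial_y u c)).
    { pose proof (is_RInt_unique _ _ _ _ HI) as HU. unfold plus at 2 in HU; simpl in HU.
      rewrite <- HU.
      apply RInt_ge_0.
      - pose proof PI_RGT_0; lra.
      - eexists; exact HI.
      - intros t _. unfold plus; simpl.
        pose proof (Hpos _ (circ_disc c r t Hr')).
        pose proof (sin2_cos2 t) as SC. unfold Rsqr in SC.
        (* Sum of the squares of a + cos t and b + sin t, with a^2 + b^2 <= 1. *)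
        assert (-1 <= a * cos t + b * sin t).
        { pose proof (Rle_0_sqr (a + cos t)) as S1. pose proof (Rle_0_sqr (b + sin t)) as S2.
          unfold Rsqr in S1, S2. lra. }
        nra. }
    pose proof PI_RGT_0.
    assert (0 <= 2 * u c + r * (a * partial_x u c + b * partial_y u c)).
    { apply (Rmult_le_reg_l PI); lra. }
    apply (Rmult_le_reg_l r); [unfold r; lra|].
    replace (r * (4 / (1 - Cmod c) * u c)) with (2 * u c) by (unfold r; field; lra). lra. }
  intros Hab. apply Rabs_le. pose proof (Key a b Hab). pose proof (Key (- a) (- b)).
  split; [lra|]. assert (- a * - a + - b * - b <= 1) by nra. lra.
Qed.

(** * Harnack's inequality *)

Lemma Rabs_le_of_derive_le (f f' : R -> R) (a b A : R) :
  (forall s, Rmin a b <= s <= Rmax a b -> is_derive f s (f' s) /\ Rabs (f' s) <= A) ->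
  Rabs (f b - f a) <= A * Rabs (b - a).
Proof.
  intros Hf. destruct (MVT_gen f a b f') as (s & Hs & Eq).
  - intros s Hs. apply Hf. lra.
  - intros s Hs. eapply is_derive_continuity_pt. apply Hf, Hs.
  - rewrite Eq, Rabs_mult. apply Rmult_le_compat_r; [apply Rabs_pos | apply Hf, Hs].
Qed.

(** The gradient bound divided by u says that ln u has slope at most 4 / (1 - |c|), hence at most 4
    / d, along any curve of speed at most 1 staying in |c| <= 1 - d. *)
Lemma Har_plus_ln_along (u : C -> R) (x y x' y' : R -> R) (a b d v : R) :
  Har_plus u -> 0 < d ->
  (forall s, Rmin a b <= s <= Rmax a b ->
     Cmod (x s, y s) <= 1 - d /\ is_derive x s (x' s) /\ is_derive y s (y' s) /\
     x' s * x' s + y' s * y' s <= 1) ->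
  Rabs (ln (u (x b, y b)) - ln (u (x a, y a))) <= 4 / d * Rabs (b - a).
Proof.
  intros Hu Hd Hs. pose proof Hu as (((Hc & _) & _) & Hpos).
  apply (Rabs_le_of_derive_le (fun s => ln (u (x s, y s)))
    (fun s => (partial_x u (x s, y s) * x' s + partial_y u (x s, y s) * y' s) * / u (x s, y s))).
  intros s Is. destruct (Hs s Is) as (Hm & Dx & Dy & Hn).
  assert (Hin : unit_disc (x s, y s)) by (unfold unit_disc; lra).
  pose proof (Hpos _ Hin) as Hp. split.
  - apply (is_derive_comp ln (fun s => u (x s, y s)) s).
    + apply is_derive_ln, Hp.
    + apply (C1_chain unit_disc); trivial. apply unit_disc_open.
  - rewrite Rabs_mult, (Rabs_right (/ _)) by (left; apply Rinv_0_lt_compat, Hp).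
    apply (Rmult_le_reg_r (u (x s, y s))); [exact Hp|].
    rewrite Rmult_assoc, Rinv_l, Rmult_1_r by lra.
    pose proof (Har_plus_gradient u (x s, y s) (x' s) (y' s) Hu Hin Hn) as G.
    rewrite (Rmult_comm (x' s)), (Rmult_comm (y' s)) in G.
    eapply Rle_trans; [exact G|]. apply Rmult_le_compat_r; [lra|].
    unfold Rdiv. apply Rmult_le_compat_l; [lra|]. apply Rinv_le_contravar; lra.
Qed.

Lemma exp_le_compat (x y : R) : x <= y -> exp x <= exp y.
Proof. intros [H| ->]; [left; apply exp_increasing, H | right; reflexivity]. Qed.

(** The path is an arc of radius r' followed by a radial segment. The angles are arbitrary reals, so
    a caller may choose representatives modulo 2 PI that make the arc short. *)
Lemma Har_plus_Harnack (u : C -> R) (r t r' t' d : R) :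
  Har_plus u -> 0 < d -> 0 <= r <= 1 - d -> 0 <= r' <= 1 - d ->
  u (polar r t) <= exp (4 / d * (Rabs (r - r') + Rabs (t - t'))) * u (polar r' t').
Proof.
  intros Hu Hd Hr Hr'. pose proof Hu as (_ & Hpos).
  assert (H1 : Rabs (ln (u (polar r t)) - ln (u (polar r' t))) <= 4 / d * Rabs (r - r')).
  { apply (Har_plus_ln_along u (fun s => s * cos t) (fun s => s * sin t)
      (fun _ => cos t) (fun _ => sin t) r' r d); trivial.
    intros s Hs. change (s * cos t, s * sin t) with (polar s t). rewrite Cmod_polar.
    assert (0 <= Rmin r' r) by (apply Rmin_glb; lra).
    assert (Rmax r' r <= 1 - d) by (apply Rmax_lub; lra).
    split; [rewrite Rabs_right; lra|]. split; [|split].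
    - auto_derive; trivial; ring.
    - auto_derive; trivial; ring.
    - pose proof (sin2_cos2 t) as SC. unfold Rsqr in SC. lra. }
  assert (H2 : Rabs (ln (u (polar r' t)) - ln (u (polar r' t'))) <= 4 / d * Rabs (t - t')).
  { apply (Har_plus_ln_along u (fun s => r' * cos s) (fun s => r' * sin s)
      (fun s => - r' * sin s) (fun s => r' * cos s) t' t d); trivial.
    intros s Hs. change (r' * cos s, r' * sin s) with (polar r' s). rewrite Cmod_polar.
    split; [rewrite Rabs_right; lra|]. split; [|split].
    - auto_derive; trivial; ring.
    - auto_derive; trivial; ring.
    - pose proof (sin2_cos2 s) as SC. unfold Rsqr in SC.
      replace (- r' * sin s * (- r' * sin s) + r' * cos s * (r' * cos s))
        with (r' * r' * (sin s * sin s + cos s * cos s)) by ring.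
      rewrite SC. nra. }
  assert (P1 : 0 < u (polar r t)).
  { apply Hpos. unfold unit_disc. rewrite Cmod_polar, Rabs_right; lra. }
  assert (P2 : 0 < u (polar r' t')).
  { apply Hpos. unfold unit_disc. rewrite Cmod_polar, Rabs_right; lra. }
  rewrite <- (exp_ln (u (polar r t))) by exact P1.
  rewrite <- (exp_ln (u (polar r' t'))) at 1 by exact P2.
  rewrite <- exp_plus. apply exp_le_compat.
  apply Rabs_le_between in H1. apply Rabs_le_between in H2. lra.
Qed.

(** * Series of Cauchy kernels *)

Lemma Series_dominated (f c : nat -> R) (K : R) :
  ex_series c -> (forall n, Rabs (f n) <= K * c n) ->
  ex_series f /\ Rabs (Series f) <= K * Series c.
Proof.
  intros Hc Hf.
  assert (HK : ex_series (fun n => K * c n)) by (apply (ex_series_scal_l K c), Hc).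
  assert (Ha : ex_series (fun n => Rabs (f n))).
  { apply (ex_series_le (K := R_AbsRing) (V := R_CompleteNormedModule) _ (fun n => K * c n)); [|exact HK].
    intros n. unfold norm; simpl; unfold abs; simpl. rewrite Rabs_Rabsolu. apply Hf. }
  split; [apply ex_series_Rabs, Ha|].
  eapply Rle_trans; [apply Series_Rabs, Ha|].
  rewrite <- Series_scal_l. apply Series_le; [|exact HK].
  intros n. split; [apply Rabs_pos | apply Hf].
Qed.

(** A quadratic remainder survives summation over the zeros, so this replaces termwise
    differentiation of the series. *)
Lemma is_derive_of_quadratic_bound (f : R -> R) (x l K e : R) :
  0 < e ->
  (forall y, Rabs (y - x) < e -> Rabs (f y - f x - (y - x) * l) <= K * (y - x) ^ 2) ->
  is_derive f x l.
Proof.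
  intros He Hf. apply is_derive_Reals. intros eps Heps.
  pose proof (Rabs_pos K) as HK.
  assert (Hd : 0 < Rmin e (eps / (Rabs K + 1))).
  { apply Rmin_glb_lt; [lra|]. apply Rdiv_lt_0_compat; lra. }
  exists (mkposreal _ Hd). intros h Hh Hlt. simpl in Hlt.
  assert (H1 : Rabs h < e) by (eapply Rlt_le_trans; [exact Hlt | apply Rmin_l]).
  assert (H2 : Rabs h < eps / (Rabs K + 1)) by (eapply Rlt_le_trans; [exact Hlt | apply Rmin_r]).
  specialize (Hf (x + h)). replace (x + h - x) with h in Hf by ring. specialize (Hf H1).
  replace ((f (x + h) - f x) / h - l) with ((f (x + h) - f x - h * l) / h) by (field; exact Hh).
  pose proof (Rabs_pos_lt h Hh) as Hp.
  unfold Rdiv. rewrite Rabs_mult, Rabs_inv.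
  apply (Rmult_lt_reg_r (Rabs h)); [exact Hp|].
  rewrite Rmult_assoc, Rinv_l, Rmult_1_r by lra.
  eapply Rle_lt_trans; [exact Hf|].
  rewrite <- (pow2_abs h). pose proof (Rle_abs K).
  assert (H3 : (Rabs K + 1) * Rabs h < eps).
  { apply (Rmult_lt_reg_l (/ (Rabs K + 1))); [apply Rinv_0_lt_compat; lra|].
    rewrite <- Rmult_assoc, Rinv_l, Rmult_1_l by lra. rewrite Rmult_comm. exact H2. }
  nra.
Qed.

Lemma Cpow_bound (p : C) (M : R) (k : nat) : Cmod p <= M -> Cmod (p ^ k) <= M ^ k.
Proof.
  intros Hp. rewrite Cmod_pow. apply pow_incr. split; [apply Cmod_ge_0 | exact Hp].
Qed.

Lemma Cpow_lipschitz (M : R) (k : nat) : exists K : R, 0 <= K /\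
  forall p q : C, Cmod p <= M -> Cmod q <= M -> Cmod (q ^ k - p ^ k) <= K * Cmod (q - p).
Proof.
  destruct (Rle_lt_dec 0 M) as [HM|HM].
  2: { exists 0; split; [lra|]. intros p q Hp. pose proof (Cmod_ge_0 p); lra. }
  induction k as [|k (K & HK & IH)].
  - exists 0; split; [lra|]. intros p q _ _. simpl.
    replace (1 - 1)%C with (RtoC 0) by ring. rewrite Cmod_0. lra.
  - exists (M * K + M ^ k). split.
    { pose proof (pow_le M k HM). nra. }
    intros p q Hp Hq.
    replace (q ^ S k - p ^ S k)%C with (q * (q ^ k - p ^ k) + (q - p) * p ^ k)%C by (simpl; ring).
    eapply Rle_trans; [apply Cmod_triangle|]. rewrite !Cmod_mult.
    pose proof (IH p q Hp Hq). pose proof (Cpow_bound p M k Hp).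
    pose proof (Cmod_ge_0 (q - p)). pose proof (Cmod_ge_0 q).
    pose proof (Cmod_ge_0 (q ^ k - p ^ k)).
    assert (Cmod q * Cmod (q ^ k - p ^ k) <= M * (K * Cmod (q - p)))
      by (apply Rmult_le_compat; assumption).
    nra.
Qed.

(** Read p = 1/s and q = 1/(s - e): the relation q - p = e p q holds, and the claim is the
    first-order Taylor expansion of s^(-k). The bound [K] depends only on [M] and [k], hence is
    uniform over all zeros. *)
Lemma Cinv_pow_expansion (M : R) (k : nat) : exists K : R, 0 <= K /\
  forall p q e : C, Cmod p <= M -> Cmod q <= M -> (q - p = e * (p * q))%C ->
  Cmod (q ^ k - p ^ k - INR k * e * p ^ S k) <= K * Cmod e ^ 2.
Proof.
  destruct (Rle_lt_dec 0 M) as [HM|HM].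
  2: { exists 0; split; [lra|]. intros p q e Hp. pose proof (Cmod_ge_0 p); lra. }
  induction k as [|k (K & HK & IH)].
  - exists 0; split; [lra|]. intros p q e _ _ _. simpl.
    replace (1 - 1 - 0 * e * (p * 1))%C with (RtoC 0) by ring. rewrite Cmod_0. lra.
  - exists (M * K + INR k * M ^ S k * M ^ 2 + M ^ k * M ^ 3).
    pose proof (pos_INR k) as Hk.
    assert (Hpow : forall j, 0 <= M ^ j) by (intros; apply pow_le; exact HM).
    split.
    { pose proof (Hpow (S k)). pose proof (Hpow 2%nat). pose proof (Hpow k). pose proof (Hpow 3%nat).
      repeat apply Rplus_le_le_0_compat; repeat first [assumption | apply Rmult_le_pos]. }
    intros p q e Hp Hq He.
    replace (q ^ S k - p ^ S k - INR (S k) * e * p ^ S (S k))%C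
      with (q * (q ^ k - p ^ k - INR k * e * p ^ S k)
            + INR k * e * p ^ S k * (q - p) + p ^ k * (q - p - e * p ^ 2))%C.
    2: { rewrite S_INR, RtoC_plus. simpl. ring. }
    (* Using the relation twice turns the first-order error into e^2 p^2 q. *)
    replace (q - p - e * p ^ 2)%C with (e ^ 2 * (p * p * q))%C.
    2: { replace (q - p - e * p ^ 2)%C with (e * p * (q - p))%C.
         - rewrite He; simpl; ring.
         - transitivity (q - p - e * p ^ 2 + (e * (p * q) - (q - p)))%C; [simpl; ring|].
           rewrite He; ring. }
    rewrite He.
    eapply Rle_trans; [apply Cmod_triangle|].
    eapply Rle_trans; [apply Rplus_le_compat_r, Cmod_triangle|].
    rewrite !Cmod_mult, !Cmod_pow, Cmod_R, (Rabs_right (INR k)) by lra.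
    pose proof (IH p q e Hp Hq He) as IH'.
    pose proof (Cmod_ge_0 p). pose proof (Cmod_ge_0 q). pose proof (Cmod_ge_0 e).
    pose proof (pow_incr (Cmod p) M k (conj H Hp)) as Pk.
    pose proof (pow_incr (Cmod p) M (S k) (conj H Hp)) as PSk.
    pose proof (pow_le _ k H). pose proof (pow_le _ (S k) H).
    assert (Hpq : 0 <= Cmod p * Cmod q <= M * M) by (split; nra).
    assert (Hppq : 0 <= Cmod p * Cmod p * Cmod q <= M * M * M).
    { assert (0 <= Cmod p * Cmod p <= M * M) by (split; nra). split; nra. }
    assert (He2 : 0 <= Cmod e ^ 2) by apply pow2_ge_0.
    assert (T1 : Cmod q * Cmod (q ^ k - p ^ k - INR k * e * p ^ S k) <= M * (K * Cmod e ^ 2))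
      by (apply Rmult_le_compat; auto using Cmod_ge_0).
    assert (T2 : Cmod p ^ S k * (Cmod p * Cmod q) <= M ^ S k * (M * M))
      by (apply Rmult_le_compat; tauto).
    assert (T3 : Cmod p ^ k * (Cmod p * Cmod p * Cmod q) <= M ^ k * (M * M * M))
      by (apply Rmult_le_compat; tauto).
    apply (Rmult_le_compat_l (INR k * Cmod e ^ 2)) in T2; [|apply Rmult_le_pos; assumption].
    apply (Rmult_le_compat_l (Cmod e ^ 2)) in T3; [|assumption].
    replace (M ^ 2) with (M * M) by ring. replace (M ^ 3) with (M * M * M) by ring.
    eapply Rle_trans; [apply Rplus_le_compat; [apply Rplus_le_compat; [exact T1|]|]|].
    + eapply Rle_trans; [|exact T2]. right; ring.
    + eapply Rle_trans; [|exact T3]. right; ring.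
    + right; ring.
Qed.

(** * Harmonicity of real parts of Cauchy kernel series *)

Definition cauchy_term (l z : C) : C := (/ (1 - Cconj l * z))%C.

(** Arbitrary bounded coefficients [al] and an arbitrary power [k] make the family closed under
    partial derivatives: each one raises [k] by 1 and multiplies [al n] by k conj(l n), with an
    extra factor i for the y-derivative. *)
Definition cauchy_series (c : nat -> R) (l al : nat -> C) (k : nat) (z : C) : R :=
  Series (fun n => c n * Re (al n * cauchy_term (l n) z ^ k)).

Lemma Cmod_1_minus (l z : C) : Cmod l <= 1 -> 1 - Cmod z <= Cmod (1 - Cconj l * z).
Proof.
  intros Hl.
  pose proof (Cmod_triangle (1 - Cconj l * z) (Cconj l * z)) as H.
  replace (1 - Cconj l * z + Cconj l * z)%C with (RtoC 1) in H by ring.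
  rewrite Cmod_1, Cmod_mult, Cmod_conj in H.
  pose proof (Cmod_ge_0 z). nra.
Qed.

Lemma denom_neq_0 (l z : C) : Cmod l <= 1 -> Cmod z < 1 -> (1 - Cconj l * z)%C <> 0.
Proof.
  intros Hl Hz E. pose proof (Cmod_1_minus l z Hl) as H. rewrite E, Cmod_0 in H. lra.
Qed.

Lemma cauchy_term_bound (l z : C) (d : R) :
  Cmod l <= 1 -> 0 < d -> Cmod z <= 1 - d -> Cmod (cauchy_term l z) <= / d.
Proof.
  intros Hl Hd Hz. unfold cauchy_term.
  rewrite Cmod_inv by (apply denom_neq_0; lra).
  apply Rinv_le_contravar; [exact Hd|].
  pose proof (Cmod_1_minus l z Hl). lra.
Qed.

Lemma cauchy_term_diff (l z w : C) :
  Cmod l <= 1 -> Cmod z < 1 -> Cmod w < 1 ->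
  (cauchy_term l w - cauchy_term l z
   = (Cconj l * (w - z)) * (cauchy_term l z * cauchy_term l w))%C.
Proof.
  intros Hl Hz Hw. unfold cauchy_term. field.
  split; apply denom_neq_0; assumption.
Qed.

Lemma Re_minus (a b : C) : Re (a - b) = Re a - Re b.
Proof. reflexivity. Qed.
Lemma Re_scal_l (a : R) (b : C) : Re (a * b) = a * Re b.
Proof. destruct b; unfold Re, RtoC, Cmult; simpl; ring. Qed.

Definition bounded_seq (al : nat -> C) := exists A, forall n, Cmod (al n) <= A.

Lemma bounded_seq_mult (al be : nat -> C) :
  bounded_seq al -> bounded_seq be -> bounded_seq (fun n => (al n * be n)%C).
Proof.
  intros [A HA] [B HB]. exists (A * B). intros n. rewrite Cmod_mult.
  apply Rmult_le_compat; auto using Cmod_ge_0.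
Qed.

Lemma bounded_seq_const (a : C) : bounded_seq (fun _ => a).
Proof. exists (Cmod a). intros; lra. Qed.

Lemma weighted_Re_bound (c : R) (a x : C) (A X : R) :
  0 <= c -> Cmod a <= A -> Cmod x <= X -> Rabs (c * Re (a * x)) <= A * X * c.
Proof.
  intros Hc Ha Hx. rewrite Rabs_mult, (Rabs_right c) by lra.
  rewrite (Rmult_comm _ c). apply Rmult_le_compat_l; [exact Hc|].
  eapply Rle_trans; [apply re_le_Cmod|]. rewrite Cmod_mult.
  apply Rmult_le_compat; auto using Cmod_ge_0.
Qed.

Lemma ex_cauchy_series (c : nat -> R) (l al : nat -> C) (k : nat) (z : C) :
  (forall n, 0 <= c n) -> ex_series c -> (forall n, Cmod (l n) <= 1) -> bounded_seq al ->
  unit_disc z -> ex_series (fun n => c n * Re (al n * cauchy_term (l n) z ^ k)).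
Proof.
  intros Hc Hs Hl [A HA] Hz. unfold unit_disc in Hz.
  apply (Series_dominated _ c (A * (/ (1 - Cmod z)) ^ k) Hs). intros n.
  apply weighted_Re_bound; auto. apply Cpow_bound, cauchy_term_bound; auto; lra.
Qed.

Lemma cauchy_series_continuous (c : nat -> R) (l al : nat -> C) (k : nat) (z : C) :
  (forall n, 0 <= c n) -> ex_series c -> (forall n, Cmod (l n) <= 1) -> bounded_seq al ->
  unit_disc z -> continuous (cauchy_series c l al k) z.
Proof.
  intros Hc Hs Hl Ha Hz. pose proof Hz as Hz'. unfold unit_disc in Hz'.
  destruct Ha as [A HA]. pose proof (ex_intro _ A HA : bounded_seq al) as Hb.
  (* Points within d of z have modulus at most 1 - d, so all kernels there are bounded by 1/d,
     uniformly in n. *)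
  set (d := (1 - Cmod z) / 2). assert (Hd : 0 < d) by (unfold d; lra).
  destruct (Cpow_lipschitz (/ d) k) as (K & HK & HL).
  set (B := A * (K * (/ d * / d)) * Series c).
  assert (HB : forall w, Cmod (w - z) < d ->
    Rabs (cauchy_series c l al k w - cauchy_series c l al k z) <= B * Cmod (w - z)).
  { intros w Hw.
    assert (Hwm : Cmod w <= 1 - d).
    { replace w with (z + (w - z))%C by ring.
      eapply Rle_trans; [apply Cmod_triangle | unfold d in *; lra]. }
    assert (Hwd : unit_disc w) by (unfold unit_disc; lra).
    unfold cauchy_series.
    rewrite <- Series_minus by (apply ex_cauchy_series; assumption).
    replace (B * Cmod (w - z)) with (A * (K * (/ d * / d) * Cmod (w - z)) * Series c)
      by (unfold B; ring).
    apply Series_dominated; [exact Hs|]. intros n.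
    replace (c n * Re (al n * cauchy_term (l n) w ^ k) - c n * Re (al n * cauchy_term (l n) z ^ k))
      with (c n * Re (al n * (cauchy_term (l n) w ^ k - cauchy_term (l n) z ^ k))).
    2: { replace (al n * (cauchy_term (l n) w ^ k - cauchy_term (l n) z ^ k))%C
          with (al n * cauchy_term (l n) w ^ k - al n * cauchy_term (l n) z ^ k)%C by ring.
         rewrite Re_minus. ring. }
    apply weighted_Re_bound; auto.
    assert (Bz : Cmod (cauchy_term (l n) z) <= / d) by (apply cauchy_term_bound; auto; unfold d; lra).
    assert (Bw : Cmod (cauchy_term (l n) w) <= / d) by (apply cauchy_term_bound; auto).
    eapply Rle_trans; [apply HL; assumption|].
    rewrite Rmult_assoc. apply Rmult_le_compat_l; [exact HK|].
    rewrite cauchy_term_diff, !Cmod_mult, Cmod_conj by (auto; lra).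
    rewrite Rmult_comm. pose proof (Cmod_ge_0 (w - z)). pose proof (Cmod_ge_0 (l n)).
    apply Rmult_le_compat; [apply Rmult_le_pos; apply Cmod_ge_0 | apply Rmult_le_pos; assumption | |].
    - apply Rmult_le_compat; auto using Cmod_ge_0.
    - specialize (Hl n). nra. }
  apply filterlim_locally. intros eps.
  pose proof (Rabs_pos B) as HB0. pose proof (cond_pos eps) as He.
  apply (locally_Cmod z _ (Rmin d (eps / (Rabs B + 1)))).
  - apply Rmin_glb_lt; [exact Hd|]. apply Rdiv_lt_0_compat; lra.
  - intros w Hw.
    assert (H1 : Cmod (w - z) < d) by (eapply Rlt_le_trans; [exact Hw | apply Rmin_l]).
    assert (H2 : Cmod (w - z) < eps / (Rabs B + 1)) by (eapply Rlt_le_trans; [exact Hw | apply Rmin_r]).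
    specialize (HB w H1).
    change (Rabs (cauchy_series c l al k w - cauchy_series c l al k z) < eps).
    eapply Rle_lt_trans; [exact HB|].
    assert (H3 : (Rabs B + 1) * Cmod (w - z) < eps).
    { apply (Rmult_lt_reg_l (/ (Rabs B + 1))); [apply Rinv_0_lt_compat; lra|].
      rewrite <- Rmult_assoc, Rinv_l, Rmult_1_l by lra. rewrite Rmult_comm. exact H2. }
    pose proof (Rle_abs B). pose proof (Cmod_ge_0 (w - z)). nra.
Qed.

(** A complex increment h serves both partial derivatives: h real gives the one in x, h purely
    imaginary the one in y. *)
Lemma cauchy_series_expansion (c : nat -> R) (l al : nat -> C) (k : nat) (z : C) :
  (forall n, 0 <= c n) -> ex_series c -> (forall n, Cmod (l n) <= 1) -> bounded_seq al ->
  unit_disc z -> exists K e, 0 < e /\ forall h : C, Cmod h < e ->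
  Rabs (cauchy_series c l al k (z + h) - cauchy_series c l al k z
        - cauchy_series c l (fun n => (h * (INR k * Cconj (l n) * al n))%C) (S k) z)
  <= K * Cmod h ^ 2.
Proof.
  intros Hc Hs Hl Ha Hz. pose proof Hz as Hz'. unfold unit_disc in Hz'.
  destruct Ha as [A HA]. pose proof (ex_intro _ A HA : bounded_seq al) as Hb.
  assert (Hbl : bounded_seq (fun n => Cconj (l n))) by (exists 1; intros; rewrite Cmod_conj; auto).
  set (d := (1 - Cmod z) / 2). assert (Hd : 0 < d) by (unfold d; lra).
  destruct (Cinv_pow_expansion (/ d) k) as (K & HK & HL).
  exists (A * K * Series c), d. split; [exact Hd|].
  intros h Hh.
  assert (Hwm : Cmod (z + h) <= 1 - d).
  { eapply Rle_trans; [apply Cmod_triangle | unfold d in *; lra]. }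
  assert (Hwd : unit_disc (z + h)%C) by (unfold unit_disc; lra).
  unfold cauchy_series.
  assert (E1 := ex_cauchy_series c l al k (z + h)%C Hc Hs Hl Hb Hwd).
  assert (E2 := ex_cauchy_series c l al k z Hc Hs Hl Hb Hz).
  assert (E3 : ex_series (fun n => c n * Re (h * (INR k * Cconj (l n) * al n) * cauchy_term (l n) z ^ S k))).
  { apply (ex_cauchy_series c l (fun n => (h * (INR k * Cconj (l n) * al n))%C)); trivial.
    apply bounded_seq_mult; [apply bounded_seq_const|].
    apply bounded_seq_mult; [|exact Hb]. apply bounded_seq_mult; [apply bounded_seq_const | exact Hbl]. }
  rewrite <- Series_minus by assumption.
  rewrite <- Series_minus; [|exact (ex_series_minus _ _ E1 E2) | exact E3].
  replace (A * K * Series c * Cmod h ^ 2) with (A * (K * Cmod h ^ 2) * Series c) by ring.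
  apply Series_dominated; [exact Hs|]. intros n.
  set (p := cauchy_term (l n) z). set (q := cauchy_term (l n) (z + h)).
  replace (c n * Re (al n * q ^ k) - c n * Re (al n * p ^ k)
           - c n * Re (h * (INR k * Cconj (l n) * al n) * p ^ S k))
    with (c n * Re (al n * (q ^ k - p ^ k - INR k * (Cconj (l n) * h) * p ^ S k))).
  2: { replace (al n * (q ^ k - p ^ k - INR k * (Cconj (l n) * h) * p ^ S k))%C
        with (al n * q ^ k - al n * p ^ k - h * (INR k * Cconj (l n) * al n) * p ^ S k)%C by ring.
       rewrite !Re_minus. ring. }
  apply weighted_Re_bound; auto.
  eapply Rle_trans; [apply HL|].
  - apply cauchy_term_bound; auto. unfold d; lra.
  - apply cauchy_term_bound; auto.
  - unfold p, q. rewrite cauchy_term_diff by (auto; lra).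
    replace (z + h - z)%C with h by ring. ring.
  - apply Rmult_le_compat_l; [exact HK|]. apply pow_incr. split; [apply Cmod_ge_0|].
    rewrite Cmod_mult, Cmod_conj. specialize (Hl n).
    pose proof (Cmod_ge_0 h). nra.
Qed.

Lemma cauchy_series_scal (c : nat -> R) (l al be : nat -> C) (k : nat) (z : C) (x : R) :
  (forall n, al n = (x * be n)%C) ->
  cauchy_series c l al k z = x * cauchy_series c l be k z.
Proof.
  intros E. unfold cauchy_series. rewrite <- Series_scal_l. apply Series_ext. intros n.
  rewrite E. replace (x * be n * cauchy_term (l n) z ^ k)%C
    with (x * (be n * cauchy_term (l n) z ^ k))%C by ring.
  rewrite Re_scal_l. ring.
Qed.

Lemma cauchy_series_C1 (c : nat -> R) (l al : nat -> C) (k : nat) :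
  (forall n, 0 <= c n) -> ex_series c -> (forall n, Cmod (l n) <= 1) -> bounded_seq al ->
  let dx := fun n => (INR k * Cconj (l n) * al n)%C in
  let dy := fun n => (Ci * (INR k * Cconj (l n) * al n))%C in
  bounded_seq dx /\ bounded_seq dy /\
  C1_on unit_disc (cauchy_series c l al k) /\
  (forall z, unit_disc z -> partial_x (cauchy_series c l al k) z = cauchy_series c l dx (S k) z) /\
  (forall z, unit_disc z -> partial_y (cauchy_series c l al k) z = cauchy_series c l dy (S k) z).
Proof.
  intros Hc Hs Hl Hb dx dy.
  assert (Hbx : bounded_seq dx).
  { apply bounded_seq_mult; [|exact Hb]. apply bounded_seq_mult; [apply bounded_seq_const|].
    exists 1; intros; rewrite Cmod_conj; auto. }
  assert (Hby : bounded_seq dy) by (apply bounded_seq_mult; [apply bounded_seq_const | exact Hbx]).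
  split; [exact Hbx|]. split; [exact Hby|].
  apply C1_intro.
  - apply unit_disc_open.
  - intros z Hz. destruct (cauchy_series_expansion c l al k z Hc Hs Hl Hb Hz) as (K & e & He & HK).
    apply (is_derive_of_quadratic_bound _ _ _ K e He). intros x Hx.
    specialize (HK (RtoC (x - Re z))). rewrite Cmod_R in HK. specialize (HK Hx).
    rewrite (cauchy_series_scal c l (fun n => (RtoC (x - Re z) * (INR k * Cconj (l n) * al n))%C)
      dx (S k) z (x - Re z)) in HK by reflexivity.
    rewrite pow2_abs in HK.
    replace (z + RtoC (x - Re z))%C with (x, Im z) in HK.
    2: { destruct z as [a b]; unfold Cplus, RtoC; simpl; f_equal; ring. }
    unfold slice_x. rewrite C_eta. exact HK.
  - intros z Hz. destruct (cauchy_series_expansion c l al k z Hc Hs Hl Hb Hz) as (K & e & He & HK).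
    apply (is_derive_of_quadratic_bound _ _ _ K e He). intros y Hy.
    specialize (HK (RtoC (y - Im z) * Ci)%C).
    rewrite Cmod_mult, Cmod_R, Cmod_Ci, Rmult_1_r in HK. specialize (HK Hy).
    rewrite (cauchy_series_scal c l (fun n => (RtoC (y - Im z) * Ci * (INR k * Cconj (l n) * al n))%C)
      dy (S k) z (y - Im z)) in HK by (intros; unfold dy; ring).
    rewrite pow2_abs in HK.
    replace (z + RtoC (y - Im z) * Ci)%C with (Re z, y) in HK.
    2: { destruct z as [a b]; unfold Cplus, Cmult, Ci, RtoC; simpl; f_equal; ring. }
    unfold slice_y. rewrite C_eta. exact HK.
  - intros z Hz. apply cauchy_series_continuous; assumption.
  - intros z Hz. apply cauchy_series_continuous; assumption.
Qed.

(** Two y-derivatives differ from two x-derivatives by the factor i^2 = -1 in the coefficients, so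
    the Laplacian cancels. *)
Lemma cauchy_series_harmonic (c : nat -> R) (l al : nat -> C) (k : nat) :
  (forall n, 0 <= c n) -> ex_series c -> (forall n, Cmod (l n) <= 1) -> bounded_seq al ->
  harmonic_on unit_disc (cauchy_series c l al k).
Proof.
  intros Hc Hs Hl Hb.
  destruct (cauchy_series_C1 c l al k Hc Hs Hl Hb) as (Bx & By & H1 & Ex & Ey).
  destruct (cauchy_series_C1 c l _ (S k) Hc Hs Hl Bx) as (_ & _ & H2 & Exx & _).
  destruct (cauchy_series_C1 c l _ (S k) Hc Hs Hl By) as (_ & _ & H3 & _ & Eyy).
  apply (harmonic_intro unit_disc _ _ _ unit_disc_open H1 H2 H3 Ex Ey).
  intros z Hz. rewrite Exx, Eyy by exact Hz.
  rewrite (cauchy_series_scal _ _ (fun n => (Ci * _)%C)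
    (fun n => (INR (S k) * Cconj (l n) * (INR k * Cconj (l n) * al n))%C) _ _ (-1)).
  - ring.
  - intros n. replace (RtoC (-1)) with (Ci * Ci)%C; [ring|].
    unfold Ci, Cmult, RtoC; simpl; f_equal; ring.
Qed.

Lemma harmonic_const (D : C -> Prop) (a : R) : open D -> harmonic_on D (fun _ => a).
Proof.
  intros Ho.
  assert (Hc : forall b, C1_on D (fun _ => b) /\
    (forall z, D z -> partial_x (fun _ => b) z = 0) /\
    (forall z, D z -> partial_y (fun _ => b) z = 0)).
  { intros b. apply (C1_intro D (fun _ => b) (fun _ => 0) (fun _ => 0)); trivial; intros z Hz;
    try apply continuous_const; apply (is_derive_const (K := R_AbsRing) (V := R_NormedModule)). }
  destruct (Hc a) as (H1 & H2 & H3). destruct (Hc 0) as (K1 & K2 & K3).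
  apply (harmonic_intro D _ (fun _ => 0) (fun _ => 0)); trivial.
  intros z Hz. rewrite K2, K3 by exact Hz. ring.
Qed.

(** * Polar coordinates and Whitney squares *)

(** With y = x/2 <= PI/4, both sin y / y and cos y are at least cos(PI/4), whose square is 1/2; now
    double the angle. *)
Lemma half_le_sin (x : R) : 0 <= x <= PI / 2 -> x / 2 <= sin x.
Proof.
  intros Hx. set (y := x / 2). assert (Hy : 0 <= y <= PI / 4) by (unfold y; lra).
  pose proof PI_RGT_0.
  assert (Hcos : forall c, 0 <= c <= PI / 4 -> cos (PI / 4) <= cos c)
    by (intros c Hc; apply cos_decr_1; lra).
  assert (H4 : 0 < cos (PI / 4)) by (apply cos_gt_0; lra).
  assert (Hsq : cos (PI / 4) * cos (PI / 4) = / 2).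
  { pose proof (cos_2a (PI / 4)) as E. replace (2 * (PI / 4)) with (PI / 2) in E by field.
    rewrite cos_PI2 in E.
    pose proof (sin2_cos2 (PI / 4)) as E2. unfold Rsqr in E2. lra. }
  assert (Hs : cos (PI / 4) * y <= sin y).
  { destruct (MVT_gen sin 0 y cos) as (c & Hc & E).
    - intros s _. apply is_derive_Reals, derivable_pt_lim_sin.
    - intros s _. apply continuity_sin.
    - rewrite Rmin_left, Rmax_right in Hc by lra. rewrite sin_0 in E.
      pose proof (Hcos c). nra. }
  replace (sin x) with (2 * (sin y * cos y)).
  2: { rewrite <- Rmult_assoc, <- sin_2a. f_equal. unfold y; field. }
  assert (cos (PI / 4) * y * cos (PI / 4) <= sin y * cos y).
  { apply Rmult_le_compat; try lra; [nra | apply Hcos, Hy]. }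
  fold y. nra.
Qed.

(** Applied to half the difference of two angles in [0, 2 PI): a small sine leaves it near -PI, 0 or
    PI, so the angles agree up to a shift by 2 PI s. *)
Lemma half_angle_near (x e : R) :
  - PI < x < PI -> Rabs (sin x) <= e ->
  exists s : R, (s = -1 \/ s = 0 \/ s = 1) /\ Rabs (x - PI * s) <= 2 * e.
Proof.
  intros Hx He. apply Rabs_le_between in He. pose proof PI_RGT_0.
  destruct (Rle_lt_dec x (- (PI / 2))) as [H1|H1]; [|destruct (Rle_lt_dec x (PI / 2)) as [H2|H2]].
  - exists (-1). split; [tauto|]. pose proof (half_le_sin (x + PI)) as Hs.
    rewrite neg_sin in Hs. apply Rabs_le. lra.
  - exists 0. split; [tauto|]. apply Rabs_le.
    destruct (Rle_lt_dec 0 x).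
    + pose proof (half_le_sin x). lra.
    + pose proof (half_le_sin (- x)) as Hs. rewrite sin_neg in Hs. lra.
  - exists 1. split; [tauto|]. pose proof (half_le_sin (PI - x)) as Hs.
    rewrite <- sin_PI_x in He. apply Rabs_le. lra.
Qed.

Lemma polar_coords (z : C) : exists r t, z = polar r t /\ r = Cmod z /\ 0 <= t < 2 * PI.
Proof.
  pose proof PI_RGT_0.
  destruct (Req_dec (Cmod z) 0) as [E|E].
  { exists 0, 0. split; [|split; [auto|lra]]. apply Cmod_eq_0 in E. rewrite E.
    unfold polar, RtoC. f_equal; ring. }
  set (r := Cmod z). assert (Hr : 0 < r) by (pose proof (Cmod_ge_0 z); unfold r; lra).
  set (x := Re z / r). set (y := Im z / r).
  assert (Hxy : x * x + y * y = 1).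
  { pose proof (Cmod2_alt z) as Hz. fold r in Hz. unfold x, y.
    replace (Re z / r * (Re z / r) + Im z / r * (Im z / r))
      with ((Re z ^ 2 + Im z ^ 2) / r ^ 2) by (field; lra).
    rewrite <- Hz. field. lra. }
  assert (Hx : -1 <= x <= 1) by nra.
  assert (Hz : forall t, cos t = x -> sin t = y -> z = polar r t).
  { intros t Hc Hs. unfold polar. rewrite Hc, Hs. unfold x, y. rewrite <- (C_eta z) at 1.
    f_equal; field; lra. }
  pose proof (acos_bound x) as Ha. pose proof (cos_acos x Hx) as Hc.
  pose proof (sin_acos x Hx) as Hs.
  assert (Hy2 : 1 - x² = y²) by (unfold Rsqr; lra). rewrite Hy2, sqrt_Rsqr_abs in Hs.
  destruct (Rle_lt_dec 0 y) as [Hy|Hy].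
  - exists r, (acos x). split; [|split; [reflexivity|lra]].
    apply Hz; [exact Hc|]. rewrite Hs. apply Rabs_right; lra.
  - exists r, (2 * PI - acos x). split; [|split; [reflexivity|]].
    + apply Hz.
      * rewrite cos_minus, cos_2PI, sin_2PI, Hc. ring.
      * rewrite sin_minus, cos_2PI, sin_2PI, Hs. rewrite Rabs_left by exact Hy. ring.
    (* Negative y excludes x = 1, which keeps the angle strictly below 2 PI. *)
    + split; [lra|]. assert (acos x <> 0); [|lra].
      intros E0. rewrite E0, sin_0 in Hs. rewrite Rabs_left in Hs by exact Hy. lra.
Qed.

Lemma pow2_pos (k : nat) : 0 < 2 ^ k.
Proof. apply pow_lt; lra. Qed.

(** Start from any n with 2^(-n) <= d and lower it until the bound fails for n - 1; d <= 1 covers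
    the case n = 0. *)
Lemma dyadic_level (d : R) : 0 < d <= 1 -> exists k : nat, / 2 ^ k <= d < 2 * / 2 ^ k.
Proof.
  intros Hd.
  destruct (pow_lt_1_zero (/ 2)) with (y := d) as [n Hn].
  { rewrite Rabs_right; lra. }
  { lra. }
  specialize (Hn n (le_n n)). rewrite pow_inv in Hn.
  pose proof (pow2_pos n) as Hp. apply Rinv_0_lt_compat in Hp.
  rewrite Rabs_right in Hn by lra. assert (Hn' : / 2 ^ n <= d) by lra. clear Hn Hp.
  induction n as [|n IH].
  - exists 0%nat. simpl in *. lra.
  - destruct (Rle_lt_dec (/ 2 ^ n) d) as [H|H]; [auto|].
    exists (S n). split; [exact Hn'|]. simpl. rewrite Rinv_mult. lra.
Qed.

Lemma whitney_cover (z : C) : unit_disc z -> exists k j, (j < 2 ^ k)%nat /\ whitney k j z.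
Proof.
  intros Hz. unfold unit_disc in Hz. pose proof (Cmod_ge_0 z).
  destruct (polar_coords z) as (r & t & Ez & Hr & Ht).
  destruct (dyadic_level (1 - r)) as [k Hk]; [lra|].
  pose proof (pow2_pos k) as Hp. pose proof (Rinv_0_lt_compat _ Hp) as Hip. pose proof PI_RGT_0.
  set (a := 2 * PI * / 2 ^ k). assert (Ha : 0 < a) by (unfold a; nra).
  destruct (nfloor_ex (t / a)) as [j Hj].
  { apply Rdiv_le_0_compat; lra. }
  exists k, j. split.
  - apply INR_lt. rewrite pow_INR. simpl (INR 2).
    apply Rle_lt_trans with (t / a); [apply Hj|].
    apply (Rmult_lt_reg_r a); [exact Ha|]. unfold Rdiv. rewrite Rmult_assoc, Rinv_l by lra.
    replace ((1 + 1) ^ k * a) with (2 * PI); [lra|]. unfold a.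
    replace (1 + 1) with 2 by ring. field. lra.
  - exists r, t. split; [exact Ez|]. split; [lra|]. split; [exact Hk|]. fold a.
    assert (Et : t = t / a * a) by (field; lra). split.
    + rewrite Et. apply Rmult_le_compat_r; [lra | apply Hj].
    + rewrite Et at 1. apply Rmult_lt_compat_r; [lra | apply Hj].
Qed.

(** * Whitney squares of the zeros near a given point *)

Lemma Cmod_polar_diff (r0 t0 r t : R) :
  Cmod (polar r0 t0 - polar r t) ^ 2 = (r - r0) ^ 2 + 4 * r * r0 * sin ((t - t0) / 2) ^ 2 /\
  Cmod (1 - Cconj (polar r t) * polar r0 t0) ^ 2
    = (1 - r * r0) ^ 2 + 4 * r * r0 * sin ((t - t0) / 2) ^ 2.
Proof.
  assert (E : cos t * cos t0 + sin t * sin t0 = 1 - 2 * sin ((t - t0) / 2) ^ 2).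
  { rewrite <- cos_minus. replace (t - t0) with (2 * ((t - t0) / 2)) at 1 by field.
    rewrite cos_2a_sin. simpl; ring. }
  pose proof (sin2_cos2 t) as S1. pose proof (sin2_cos2 t0) as S2. unfold Rsqr in S1, S2.
  rewrite !Cmod2_alt. unfold polar, Cminus, Cplus, Copp, Cmult, Cconj, RtoC, Re, Im; simpl.
  split.
  - transitivity (r0 * r0 * (sin t0 * sin t0 + cos t0 * cos t0) + r * r * (sin t * sin t + cos t * cos t)
      - 2 * r * r0 * (cos t * cos t0 + sin t * sin t0)); [ring|].
    rewrite S1, S2, E. simpl; ring.
  - transitivity (1 - 2 * r * r0 * (cos t * cos t0 + sin t * sin t0)
      + r * r * (r0 * r0) * (sin t * sin t + cos t * cos t) * (sin t0 * sin t0 + cos t0 * cos t0)); [ring|].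
    rewrite S1, S2, E. simpl; ring.
Qed.

Lemma pseudohyp_div (z l : C) : unit_disc z -> unit_disc l ->
  pseudohyp z l = Cmod (z - l) / Cmod (1 - Cconj l * z).
Proof.
  unfold unit_disc; intros Hz Hl. unfold pseudohyp. apply Cmod_div.
  apply denom_neq_0; lra.
Qed.

Lemma denom_pos (z l : C) : unit_disc z -> unit_disc l -> 0 < Cmod (1 - Cconj l * z).
Proof.
  unfold unit_disc; intros Hz Hl. pose proof (Cmod_1_minus l z). lra.
Qed.

(** Both squared moduli in rho contain the same term 4 r r0 sin^2, so rho < 1/3 squared reads 9 (r -
    r0)^2 + 32 r r0 sin^2 < (1 - r r0)^2, with 32 = 4 (9 - 1). Since 1 - r r0 <= (1 - r) + (1 - r0),
    the radial term gives the factors 2, after which 1 - r r0 <= 3 (1 - r) bounds the sine. *)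
Lemma near_polar (r0 t0 r t : R) :
  0 <= r0 < 1 -> 0 <= r < 1 -> pseudohyp (polar r0 t0) (polar r t) < 1 / 3 ->
  1 - r < 2 * (1 - r0) /\ 1 - r0 < 2 * (1 - r) /\
  32 * (r * r0 * sin ((t - t0) / 2) ^ 2) <= 9 * (1 - r) ^ 2.
Proof.
  intros H0 H1 Hr.
  assert (D0 : unit_disc (polar r0 t0)) by (unfold unit_disc; rewrite Cmod_polar, Rabs_right; lra).
  assert (D1 : unit_disc (polar r t)) by (unfold unit_disc; rewrite Cmod_polar, Rabs_right; lra).
  rewrite pseudohyp_div in Hr by assumption.
  pose proof (denom_pos _ _ D0 D1) as HD.
  destruct (Cmod_polar_diff r0 t0 r t) as [E1 E2].
  set (A := Cmod (polar r0 t0 - polar r t)) in *.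
  set (B := Cmod (1 - Cconj (polar r t) * polar r0 t0)) in *.
  assert (HA : 0 <= A) by apply Cmod_ge_0.
  assert (H3 : 3 * A < B).
  { apply (Rmult_lt_compat_r B) in Hr; [|exact HD]. unfold Rdiv in Hr.
    rewrite Rmult_assoc, Rinv_l in Hr by lra. lra. }
  assert (H9 : 9 * A ^ 2 < B ^ 2) by nra.
  rewrite E1, E2 in H9.
  set (s2 := sin ((t - t0) / 2) ^ 2) in *.
  assert (Hs : 0 <= r * r0 * s2).
  { apply Rmult_le_pos; [nra|]. unfold s2. apply pow2_ge_0. }
  assert (H10 : (3 * (r - r0)) ^ 2 < (1 - r * r0) ^ 2) by lra.
  assert (Hrr : 0 < 1 - r * r0) by nra.
  assert (Habs : - (1 - r * r0) < 3 * (r - r0) < 1 - r * r0) by (split; nra).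
  assert (Hdd : 1 - r * r0 <= (1 - r) + (1 - r0)) by nra.
  assert (Hd : 1 - r < 2 * (1 - r0)) by lra.
  assert (Hd0 : 1 - r0 < 2 * (1 - r)) by lra.
  split; [exact Hd|]. split; [exact Hd0|].
  assert ((1 - r * r0) ^ 2 <= (3 * (1 - r)) ^ 2) by (apply pow_incr; lra).
  pose proof (pow2_ge_0 (r - r0)). nra.
Qed.

(* The shift by [2 PI s] accounts for the wrap-around of the angle. *)
Lemma near_whitney (k j : nat) (l : C) (r0 t0 : R) :
  (j < 2 ^ k)%nat -> whitney k j l -> 0 <= r0 < 1 -> 0 <= t0 < 2 * PI ->
  pseudohyp (polar r0 t0) l < 1 / 3 ->
  / 2 ^ k < 2 * (1 - r0) < 8 * / 2 ^ k /\
  exists s, (s = -1 \/ s = 0 \/ s = 1) /\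
    Rabs (INR j * (2 * PI * / 2 ^ k) - (t0 + 2 * PI * s)) <= 5 * (2 * PI * / 2 ^ k).
Proof.
  intros Hj (r & t & -> & Hr & Hk & Ht) H0 Ht0 Hn.
  destruct (near_polar r0 t0 r t H0 Hr Hn) as (Hd & Hd0 & Hs).
  pose proof PI_RGT_0. pose proof (pow2_pos k) as Hp. pose proof (Rinv_0_lt_compat _ Hp) as Hip.
  set (a := 2 * PI * / 2 ^ k) in *. assert (Ha : 0 < a) by (unfold a; nra).
  assert (Hj0 : 0 <= INR j * a) by (apply Rmult_le_pos; [apply pos_INR | lra]).
  assert (Hj1 : (INR j + 1) * a <= 2 * PI).
  { replace (2 * PI) with (2 ^ k * a) by (unfold a; field; lra).
    apply Rmult_le_compat_r; [lra|]. replace (2 ^ k) with (INR (2 ^ k)) by (rewrite pow_INR; reflexivity).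
    rewrite <- S_INR. apply le_INR. lia. }
  split; [lra|].
  assert (Hsh : exists s, (s = -1 \/ s = 0 \/ s = 1) /\ Rabs (t - (t0 + 2 * PI * s)) <= 4 * a).
  { destruct (Nat.le_gt_cases k 2) as [Hk2|Hk2].
    - exists 0. split; [tauto|].
      assert (2 ^ k <= 4). { replace 4 with (2 ^ 2) by ring. apply Rle_pow; [lra | exact Hk2]. }
      assert (2 * PI <= 4 * a).
      { replace (2 * PI) with (2 ^ k * a) by (unfold a; field; lra). nra. }
      apply Rabs_le. lra.
    - assert (H8 : 8 <= 2 ^ k). { replace 8 with (2 ^ 3) by ring. apply Rle_pow; [lra | exact Hk2]. }
      assert (Hi8 : / 2 ^ k <= / 8) by (apply Rinv_le_contravar; lra).
      assert (Hrr : 3 / 8 <= r * r0) by nra.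
      set (x := (t - t0) / 2) in *.
      pose proof (pow2_ge_0 (sin x)) as Hs2.
      assert (Hsd : Rabs (sin x) <= 1 - r).
      { apply Rsqr_incr_0; [|apply Rabs_pos | lra].
        rewrite <- Rsqr_abs. rewrite !Rsqr_pow2. nra. }
      destruct (half_angle_near x (1 - r)) as (s & Hs3 & Hx); [unfold x; lra | exact Hsd|].
      exists s. split; [exact Hs3|].
      replace (t - (t0 + 2 * PI * s)) with (2 * (x - PI * s)) by (unfold x; field).
      rewrite Rabs_mult, (Rabs_right 2) by lra.
      assert (8 * / 2 ^ k <= 4 * a); [|lra].
      unfold a. pose proof PI2_1. nra. }
  destruct Hsh as (s & Hs3 & Hx). exists s. split; [exact Hs3|].
  apply Rabs_le_between in Hx. apply Rabs_le. lra.
Qed.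

(** [Har_plus_Harnack] with d = 2^(-k)/2, radial distance at most 4 * 2^(-k) and angular distance at
    most 6 widths 2 PI 2^(-k); the level k cancels. *)
Definition Harnack_const : R := exp (8 * (4 + 12 * PI)).

Lemma polar_shift (r t s : R) : s = -1 \/ s = 0 \/ s = 1 -> polar r (t + 2 * PI * s) = polar r t.
Proof.
  intros Hs. unfold polar.
  rewrite cos_plus, sin_plus.
  assert (E : cos (2 * PI * s) = 1 /\ sin (2 * PI * s) = 0).
  { destruct Hs as [->|[->| ->]].
    - replace (2 * PI * -1) with (- (2 * PI)) by ring. rewrite cos_neg, sin_neg, cos_2PI, sin_2PI.
      split; ring.
    - rewrite Rmult_0_r, cos_0, sin_0. tauto.
    - rewrite Rmult_1_r, cos_2PI, sin_2PI. tauto. }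
  destruct E as [-> ->]. f_equal; ring.
Qed.

(** The square is that of a zero near z, not the one containing z, because the hypothesis speaks
    only about squares that contain zeros. *)
Lemma near_whitney_Harnack (k j : nat) (z l : C) (u : C -> R) :
  (j < 2 ^ k)%nat -> whitney k j l -> unit_disc z -> pseudohyp z l < 1 / 3 -> Har_plus u ->
  u z <= Harnack_const * u (whitney_center k j) /\
  u (whitney_center k j) <= Harnack_const * u z.
Proof.
  intros Hj Hl Hz Hn Hu. unfold unit_disc in Hz. pose proof (Cmod_ge_0 z) as Hz0.
  destruct (polar_coords z) as (r0 & t0 & -> & Hr0 & Ht0). rewrite <- Hr0 in Hz, Hz0.
  destruct (near_whitney k j l r0 t0 Hj Hl (conj Hz0 Hz) Ht0 Hn) as (Hk & s & Hs & Hx).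
  rewrite <- (polar_shift r0 t0 s Hs).
  pose proof PI_RGT_0. pose proof (pow2_pos k) as Hp. pose proof (Rinv_0_lt_compat _ Hp) as Hip.
  assert (Hi1 : / 2 ^ k <= 1).
  { rewrite <- Rinv_1. apply Rinv_le_contravar; [lra|]. apply pow_R1_Rle; lra. }
  set (a := 2 * PI * / 2 ^ k) in *. assert (Ha : 0 < a) by (unfold a; nra).
  apply Rabs_le_between in Hx.
  unfold whitney_center. fold a.
  set (rc := Rmax 0 (1 - 3 / 2 * / 2 ^ k)). set (tc := (INR j + 1 / 2) * a).
  set (t1 := t0 + 2 * PI * s) in *. set (d := / 2 ^ k / 2).
  assert (Hd : 0 < d) by (unfold d; lra).
  assert (Hrc : 0 <= rc <= 1 - / 2 ^ k /\ 1 - 3 / 2 * / 2 ^ k <= rc).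
  { unfold rc. split; [split|]; [apply Rmax_l | apply Rmax_lub; lra | apply Rmax_r]. }
  assert (HK : 4 / d * (4 * / 2 ^ k + 6 * a) = 8 * (4 + 12 * PI)).
  { unfold d, a. field. lra. }
  assert (Hr0d : 0 <= r0 <= 1 - d) by (unfold d; lra).
  assert (Hrcd : 0 <= rc <= 1 - d) by (unfold d; lra).
  assert (A1 : Rabs (r0 - rc) <= 4 * / 2 ^ k) by (apply Rabs_le; lra).
  assert (A2 : Rabs (t1 - tc) <= 6 * a) by (apply Rabs_le; unfold tc; lra).
  assert (Hle : 4 / d * (Rabs (r0 - rc) + Rabs (t1 - tc)) <= 8 * (4 + 12 * PI)).
  { rewrite <- HK. apply Rmult_le_compat_l; [apply Rdiv_le_0_compat; lra | lra]. }
  assert (Dz : unit_disc (polar r0 t1)) by (unfold unit_disc; rewrite Cmod_polar, Rabs_right; lra).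
  assert (Dc : unit_disc (polar rc tc)) by (unfold unit_disc; rewrite Cmod_polar, Rabs_right; lra).
  pose proof (proj2 Hu _ Dz) as Pz. pose proof (proj2 Hu _ Dc) as Pc. split.
  - eapply Rle_trans; [apply (Har_plus_Harnack u r0 t1 rc tc d Hu Hd Hr0d Hrcd)|].
    apply Rmult_le_compat_r; [lra|]. apply exp_le_compat, Hle.
  - eapply Rle_trans; [apply (Har_plus_Harnack u rc tc r0 t1 d Hu Hd Hrcd Hr0d)|].
    apply Rmult_le_compat_r; [lra|]. apply exp_le_compat.
    rewrite (Rabs_minus_sym rc), (Rabs_minus_sym tc). exact Hle.
Qed.

(** The candidates run from up x - 6 to up x + 4. For negative x the truncations in [Z.to_nat] and
    [-] only repeat entries; no natural number in range is lost. *)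
Lemma nats_near (x : R) : exists L : list nat, length L = 11%nat /\
  forall j, Rabs (INR j - x) <= 5 -> In j L.
Proof.
  destruct (archimed x) as [U1 U2]. set (m := Z.to_nat (up x)).
  exists (map (fun i => (m + i - 6)%nat) (seq 0 11)). split; [reflexivity|].
  intros j Hj. apply Rabs_le_between in Hj. rewrite INR_IZR_INZ in Hj.
  assert (H1 : (Z.of_nat j <= up x + 4)%Z).
  { apply Z.lt_succ_r, lt_IZR. rewrite succ_IZR, plus_IZR. lra. }
  assert (H2 : (up x - 6 <= Z.of_nat j)%Z).
  { apply le_IZR. rewrite minus_IZR. lra. }
  apply in_map_iff. exists (j + 6 - m)%nat. unfold m in *.
  split; [|apply in_seq]; lia.
Qed.

(** The count is 3 levels times 3 angular shifts times 11 positions. The list may contain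
    repetitions and pairs with j >= 2^k; only its length and its covering property matter. *)
Lemma near_cells (z : C) : unit_disc z -> exists L : list (nat * nat), length L = 99%nat /\
  forall k j l, (j < 2 ^ k)%nat -> whitney k j l -> pseudohyp z l < 1 / 3 -> In (k, j) L.
Proof.
  intros Hz. unfold unit_disc in Hz. pose proof (Cmod_ge_0 z) as Hz0.
  destruct (polar_coords z) as (r0 & t0 & -> & Hr0 & Ht0). rewrite <- Hr0 in Hz, Hz0.
  destruct (dyadic_level (1 - r0)) as [k0 Hk0]; [lra|].
  pose proof PI_RGT_0.
  set (x := fun (k : nat) s => (t0 + 2 * PI * s) / (2 * PI * / 2 ^ k)).
  assert (Hk : forall k, exists L : list (nat * nat), length L = 33%nat /\
    forall j l, (j < 2 ^ k)%nat -> whitney k j l -> pseudohyp (polar r0 t0) l < 1 / 3 -> In (k, j) L).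
  { intros k.
    destruct (nats_near (x k (-1))) as (L1 & E1 & H1).
    destruct (nats_near (x k 0)) as (L2 & E2 & H2).
    destruct (nats_near (x k 1)) as (L3 & E3 & H3).
    exists (map (pair k) (L1 ++ L2 ++ L3)). split.
    { rewrite length_map, !length_app, E1, E2, E3. reflexivity. }
    intros j l Hj Hl Hn. apply in_map, in_or_app.
    destruct (near_whitney k j l r0 t0 Hj Hl (conj Hz0 Hz) Ht0 Hn) as (_ & s & Hs & Hx).
    pose proof (pow2_pos k) as Hp. pose proof (Rinv_0_lt_compat _ Hp) as Hip.
    assert (Hjx : Rabs (INR j - x k s) <= 5).
    { unfold x. set (a := 2 * PI * / 2 ^ k) in *. assert (Ha : 0 < a) by (unfold a; nra).
      apply (Rmult_le_reg_r a); [exact Ha|].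
      rewrite <- (Rabs_right a) at 2 by lra. rewrite <- Rabs_mult.
      replace ((INR j - (t0 + 2 * PI * s) / a) * a) with (INR j * a - (t0 + 2 * PI * s))
        by (field; lra). exact Hx. }
    destruct Hs as [->|[->| ->]]; [left; auto | right; apply in_or_app; left; auto
      | right; apply in_or_app; right; auto]. }
  destruct (Hk (k0 - 1)%nat) as (L1 & E1 & H1). destruct (Hk k0) as (L2 & E2 & H2).
  destruct (Hk (k0 + 1)%nat) as (L3 & E3 & H3).
  exists (L1 ++ L2 ++ L3). split; [rewrite !length_app, E1, E2, E3; reflexivity|].
  intros k j l Hj Hl Hn.
  assert (Hkk : (k <= k0 + 1)%nat /\ (k0 <= k + 1)%nat).
  { destruct Hl as (r & t & -> & Hr & Hkr & _).
    destruct (near_polar r0 t0 r t (conj Hz0 Hz) Hr Hn) as (Hd & Hd0 & _).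
    (* 1 - r and 1 - r0 differ by less than a factor 2, and each fixes its level up to a factor 2; a
       strict ratio below 4 forces adjacent levels. *)
    assert (Hlev : forall m n : nat, / 2 ^ m < 4 * / 2 ^ n -> (n <= m + 1)%nat).
    { intros m n Hmn. apply Nat.nlt_ge. intros Hlt.
      assert (Hpow : 2 ^ (m + 2) <= 2 ^ n) by (apply Rle_pow; [lra | lia]).
      rewrite pow_add in Hpow. pose proof (pow2_pos m). pose proof (pow2_pos n).
      assert (Hinv : / 2 ^ n <= / (2 ^ m * 2 ^ 2)) by (apply Rinv_le_contravar; nra).
      rewrite Rinv_mult in Hinv. lra. }
    split; apply Hlev; lra. }
  apply in_or_app.
  assert (Hc : k = (k0 - 1)%nat \/ k = k0 \/ k = (k0 + 1)%nat) by lia.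
  destruct Hc as [->|[->| ->]]; [left; eauto | right; apply in_or_app; left; eauto
    | right; apply in_or_app; right; eauto].
Qed.

(** * Blaschke products *)

Lemma one_minus_pseudohyp2 (z l : C) : unit_disc z -> unit_disc l ->
  1 - pseudohyp z l ^ 2
  = (1 - Cmod z ^ 2) * (1 - Cmod l ^ 2) / Cmod (1 - Cconj l * z) ^ 2.
Proof.
  intros Hz Hl. pose proof (denom_pos z l Hz Hl) as HD.
  rewrite pseudohyp_div by assumption.
  apply (Rmult_eq_reg_r (Cmod (1 - Cconj l * z) ^ 2)); [|apply pow_nonzero; lra].
  replace ((1 - (Cmod (z - l) / Cmod (1 - Cconj l * z)) ^ 2) * Cmod (1 - Cconj l * z) ^ 2)
    with (Cmod (1 - Cconj l * z) ^ 2 - Cmod (z - l) ^ 2) by (field; lra).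
  replace ((1 - Cmod z ^ 2) * (1 - Cmod l ^ 2) / Cmod (1 - Cconj l * z) ^ 2 * Cmod (1 - Cconj l * z) ^ 2)
    with ((1 - Cmod z ^ 2) * (1 - Cmod l ^ 2)) by (field; lra).
  rewrite !Cmod2_alt. destruct z as [a b], l as [c d].
  unfold Cminus, Cplus, Copp, Cmult, Cconj, RtoC, Re, Im; simpl; ring.
Qed.

(* The harmonic function [Re (2 / (1 - conj l z)) - 1 = (1 - |l z|^2) / |1 - conj l z|^2]
   plays the role of the Poisson kernel at [l]. *)
Lemma kernel_value (z l : C) : unit_disc z -> Cmod l <= 1 ->
  Re (2 * cauchy_term l z ^ 1) - 1
  = (1 - Cmod l ^ 2 * Cmod z ^ 2) / Cmod (1 - Cconj l * z) ^ 2.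
Proof.
  intros Hz Hl. unfold unit_disc in Hz.
  assert (HD : 0 < Cmod (1 - Cconj l * z)) by (pose proof (Cmod_1_minus l z Hl); lra).
  apply (Rmult_eq_reg_r (Cmod (1 - Cconj l * z) ^ 2)); [|apply pow_nonzero; lra].
  replace ((1 - Cmod l ^ 2 * Cmod z ^ 2) / Cmod (1 - Cconj l * z) ^ 2 * Cmod (1 - Cconj l * z) ^ 2)
    with (1 - Cmod l ^ 2 * Cmod z ^ 2) by (field; lra).
  replace (2 * cauchy_term l z ^ 1)%C with (2 * cauchy_term l z)%C by (simpl; ring).
  rewrite Re_scal_l. unfold cauchy_term.
  assert (HD2 : 0 < Cmod (1 - Cconj l * z) ^ 2) by (apply pow_lt; exact HD).
  rewrite Cmod2_alt in HD2 |- *. rewrite !Cmod2_alt.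
  unfold Cinv. set (w := (1 - Cconj l * z)%C) in *.
  change (Re (fst w / (fst w ^ 2 + snd w ^ 2), - snd w / (fst w ^ 2 + snd w ^ 2)))
    with (Re w / (Re w ^ 2 + Im w ^ 2)).
  replace ((2 * (Re w / (Re w ^ 2 + Im w ^ 2)) - 1) * (Re w ^ 2 + Im w ^ 2))
    with (2 * Re w - (Re w ^ 2 + Im w ^ 2)) by (field; lra).
  unfold w. destruct z as [a b], l as [c d].
  unfold Cminus, Cplus, Copp, Cmult, Cconj, RtoC, Re, Im; simpl; ring.
Qed.

Lemma kernel_ge_0 (z l : C) : unit_disc z -> Cmod l <= 1 ->
  0 <= Re (2 * cauchy_term l z ^ 1) - 1.
Proof.
  intros Hz Hl. rewrite kernel_value by assumption. unfold unit_disc in Hz.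
  pose proof (Cmod_ge_0 z). pose proof (Cmod_ge_0 l).
  assert (HD : 0 < Cmod (1 - Cconj l * z)) by (pose proof (Cmod_1_minus l z Hl); lra).
  apply Rdiv_le_0_compat; [|apply pow_lt, HD].
  assert (0 <= Cmod l * Cmod z <= 1) by (split; nra). nra.
Qed.

(** In the exact formula for 1 - rho^2, 1 - |z|^2 is replaced by the larger 1 - |l z|^2, which makes
    the bound harmonic in z. *)
Lemma one_minus_pseudohyp2_le (z l : C) : unit_disc z -> unit_disc l ->
  1 - pseudohyp z l ^ 2 <= (1 - Cmod l ^ 2) * (Re (2 * cauchy_term l z ^ 1) - 1).
Proof.
  intros Hz Hl. pose proof (denom_pos z l Hz Hl) as HD.
  rewrite one_minus_pseudohyp2 by assumption.
  unfold unit_disc in *. rewrite kernel_value by (unfold unit_disc; lra).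
  pose proof (Cmod_ge_0 z). pose proof (Cmod_ge_0 l).
  unfold Rdiv. rewrite <- Rmult_assoc. apply Rmult_le_compat_r.
  { left. apply Rinv_0_lt_compat, pow_lt, HD. }
  rewrite (Rmult_comm (1 - Cmod z ^ 2)). apply Rmult_le_compat_l; [nra|].
  assert (Cmod l ^ 2 <= 1) by nra. pose proof (pow2_ge_0 (Cmod z)). nra.
Qed.

Lemma pseudohyp_le_1 (z l : C) : unit_disc z -> unit_disc l -> pseudohyp z l <= 1.
Proof.
  intros Hz Hl. pose proof (one_minus_pseudohyp2 z l Hz Hl) as E.
  pose proof (denom_pos z l Hz Hl) as HD. unfold unit_disc in *.
  pose proof (Cmod_ge_0 z). pose proof (Cmod_ge_0 l).
  assert (0 <= 1 - pseudohyp z l ^ 2).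
  { rewrite E. apply Rdiv_le_0_compat; [|apply pow_lt, HD]. apply Rmult_le_pos; nra. }
  nra.
Qed.

(** From 1 + y <= exp y at y = -2 ln x: -2 ln x <= (1 - x^2) / x^2, and 1/x^2 <= 9. *)
Lemma neg_ln_le (x : R) : 1 / 3 <= x <= 1 -> - ln x <= 9 / 2 * (1 - x ^ 2).
Proof.
  intros Hx. pose proof (exp_ineq1_le (- ln x + - ln x)) as E.
  rewrite exp_plus, exp_Ropp, exp_ln in E by lra.
  assert (Hi : / x * / x - 1 <= 9 * (1 - x ^ 2)); [|lra].
  replace (/ x * / x - 1) with ((1 - x ^ 2) * (/ x * / x)) by (field; lra).
  assert (0 < / x) by (apply Rinv_0_lt_compat; lra).
  assert (/ x <= 3) by (replace 3 with (/ (1 / 3)) by field; apply Rinv_le_contravar; lra).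
  assert (/ x * / x <= 9) by nra.
  rewrite (Rmult_comm 9). apply Rmult_le_compat_l; nra.
Qed.

Lemma Cmod_blaschke_factor (l z : C) : unit_disc z -> unit_disc l ->
  Cmod (blaschke_factor l z) = pseudohyp z l.
Proof.
  intros Hz Hl. unfold blaschke_factor. destruct (Req_EM_T (Cmod l) 0) as [E|E].
  - apply Cmod_eq_0 in E. subst l. unfold pseudohyp. f_equal.
    replace (Cconj 0) with (RtoC 0) by (unfold Cconj, RtoC; simpl; f_equal; ring).
    field.
  - rewrite Cmod_mult, Cmod_div.
    2: { intros H0. apply E. rewrite H0. apply Cmod_0. }
    rewrite Cmod_R, Rabs_right by (apply Rle_ge, Cmod_ge_0).
    replace (Cmod l / Cmod l) with 1 by (field; exact E). rewrite Rmult_1_l.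
    rewrite pseudohyp_div by assumption. unfold unit_disc in *.
    rewrite Cmod_div by (apply denom_neq_0; lra). f_equal.
    rewrite <- Cmod_opp. f_equal. ring.
Qed.

(** * Finite sums and the covering estimate *)

Fixpoint lsum {A : Type} (f : A -> R) (s : list A) : R :=
  match s with [] => 0 | x :: s' => f x + lsum f s' end.

Lemma lsum_app {A : Type} (f : A -> R) (s1 s2 : list A) :
  lsum f (s1 ++ s2) = lsum f s1 + lsum f s2.
Proof. induction s1 as [|x s1 IH]; simpl; [ring | rewrite IH; ring]. Qed.

Lemma lsum_plus {A : Type} (f g : A -> R) (s : list A) :
  lsum (fun x => f x + g x) s = lsum f s + lsum g s.
Proof. induction s as [|x s IH]; simpl; [ring | rewrite IH; ring]. Qed.

Lemma lsum_le {A : Type} (f g : A -> R) (s : list A) :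
  (forall x, In x s -> f x <= g x) -> lsum f s <= lsum g s.
Proof.
  induction s as [|x s IH]; simpl; intros Hfg; [lra|].
  apply Rplus_le_compat; auto.
Qed.

Lemma lsum_const {A : Type} (a : R) (s : list A) : lsum (fun _ => a) s = INR (length s) * a.
Proof.
  induction s as [|x s IH]; simpl length; [simpl; ring|].
  rewrite S_INR. simpl. rewrite IH. ring.
Qed.

Lemma lsum_swap {A B : Type} (f : A -> B -> R) (s : list A) (s' : list B) :
  lsum (fun x => lsum (f x) s') s = lsum (fun y => lsum (fun x => f x y) s) s'.
Proof.
  induction s as [|x s IH]; simpl.
  - rewrite lsum_const. ring.
  - rewrite IH, <- lsum_plus. reflexivity.
Qed.

Lemma lsum_filter {A : Type} (b : A -> bool) (h : R) (s : list A) :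
  lsum (fun x => if b x then h else 0) s = INR (length (filter b s)) * h.
Proof.
  induction s as [|x s IH]; [simpl; ring|].
  simpl. rewrite IH. destruct (b x); simpl length; [rewrite S_INR|]; ring.
Qed.

Lemma lsum_nonneg_in {A : Type} (f : A -> R) (s : list A) (x : A) :
  (forall y, 0 <= f y) -> In x s -> f x <= lsum f s.
Proof.
  intros Hf. induction s as [|y s IH]; simpl; [tauto|].
  assert (H0 : 0 <= lsum f s).
  { clear IH. induction s as [|w s IH]; simpl; [lra|]. specialize (Hf w). lra. }
  intros [->|Hx]; [lra|]. specialize (IH Hx). specialize (Hf y). lra.
Qed.

(** Each exceptional term is charged h in every cell of [L] that contains it; exchanging the sums
    over terms and cells bounds the total charge by M per cell. Overlapping cells only increase the
    right side. *)
Lemma lsum_covering {A B : Type} (f g : A -> R) (b : B -> A -> bool) (h M : R)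
  (s : list A) (L : list B) :
  0 <= h ->
  (forall x, In x s -> f x <= g x \/ (0 <= g x /\ f x <= h /\ exists y, In y L /\ b y x = true)) ->
  (forall y, INR (length (filter (b y) s)) * h <= M) ->
  lsum f s <= lsum g s + INR (length L) * M.
Proof.
  intros Hh Hf Hb.
  assert (H1 : lsum f s <= lsum (fun x => g x + lsum (fun y => if b y x then h else 0) L) s).
  { apply lsum_le. intros x Hx.
    assert (Hnn : forall y, 0 <= if b y x then h else 0) by (intros y; destruct (b y x); lra).
    destruct (Hf x Hx) as [H|(Hg & H & y & Hy & Hby)].
    - assert (0 <= lsum (fun y => if b y x then h else 0) L); [|lra].
      clear - Hnn. induction L as [|y L IH]; simpl; [lra|]. specialize (Hnn y). lra.
    - pose proof (lsum_nonneg_in _ L y Hnn Hy) as H2. simpl in H2. rewrite Hby in H2. lra. }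
  rewrite lsum_plus, (lsum_swap (fun x y => if b y x then h else 0)) in H1.
  eapply Rle_trans; [exact H1|]. apply Rplus_le_compat_l.
  rewrite <- lsum_const. apply lsum_le. intros y _. rewrite lsum_filter. apply Hb.
Qed.

Lemma lsum_le_Series (f : nat -> R) (n : nat) :
  (forall m, 0 <= f m) -> ex_series f -> lsum f (seq 0 n) <= Series f.
Proof.
  intros Hf Hs.
  assert (Hsum : forall n, lsum f (seq 0 (S n)) = sum_n f n).
  { clear n. intros n. induction n as [|n IH].
    - rewrite sum_O. simpl. ring.
    - rewrite sum_Sn, <- IH, (seq_S (S n)), lsum_app. simpl. unfold plus; simpl. ring. }
  (* [sum_n f n] has n + 1 terms, so one nonnegative term is added first. *)
  apply Rle_trans with (lsum f (seq 0 (S n))).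
  - rewrite seq_S, lsum_app. simpl. specialize (Hf n). lra.
  - rewrite Hsum. apply (is_lim_seq_incr_compare (sum_n f)).
    + apply (Series_correct f Hs).
    + intros m. rewrite sum_Sn. unfold plus; simpl. specialize (Hf (S m)). lra.
Qed.

(** * Partial products and counting of zeros *)

Definition zero_cost (lam : zero_seq) (z : C) (n : nat) : R :=
  match lam n with Some l => - ln (pseudohyp z l) | None => 0 end.

(** Positivity of rho keeps [ln] away from its default value at 0, so the product of the factors is
    the exponential of minus the sum of the costs. *)
Lemma Cmod_blaschke_partial (lam : zero_seq) (z : C) (n : nat) :
  unit_disc z -> (forall l, is_zero_of lam l -> unit_disc l /\ 0 < pseudohyp z l) ->
  Cmod (blaschke_partial lam n z) = exp (- lsum (zero_cost lam z) (seq 0 n)).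
Proof.
  intros Hz Hl. induction n as [|n IH].
  - simpl. rewrite Ropp_0, exp_0. apply Cmod_1.
  - rewrite seq_S, lsum_app. simpl. rewrite Cmod_mult, IH.
    replace (- (lsum (zero_cost lam z) (seq 0 n) + (zero_cost lam z n + 0)))
      with (- lsum (zero_cost lam z) (seq 0 n) + - zero_cost lam z n) by ring.
    rewrite exp_plus. f_equal. unfold zero_cost. destruct (lam n) as [l|] eqn:E.
    + destruct (Hl l) as [Hd Hp]; [exists n; exact E|].
      rewrite Cmod_blaschke_factor by assumption. rewrite Ropp_involutive. symmetry. apply exp_ln, Hp.
    + rewrite Ropp_0, exp_0. apply Cmod_1.
Qed.

Lemma Cmod_limit_ge (c b : C) (a : nat -> C) (m : R) :
  Cmod c = 1 -> (forall n, m <= Cmod (a n)) ->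
  filterlim (fun n => (c * a n)%C) eventually (locally b) -> m <= Cmod b.
Proof.
  intros Hc Ha Hlim. apply Rnot_lt_le. intros Hlt.
  set (e := (m - Cmod b) / 2). assert (He : 0 < e) by (unfold e; lra).
  destruct (Hlim (ball b e)) as [N HN].
  { exists (mkposreal _ He). tauto. }
  specialize (HN N (le_n N)). apply ball_Cmod_lt in HN.
  pose proof (Cmod_triangle b (c * a N - b)) as HT.
  replace (b + (c * a N - b))%C with (c * a N)%C in HT by ring.
  rewrite Cmod_mult, Hc, Rmult_1_l in HT. specialize (Ha N). unfold e in HN. lra.
Qed.

(** Classical truth value, so that [filter] can select zeros by undecidable geometric conditions. *)
Definition holds (P : Prop) : bool := if excluded_middle_informative P then true else false.

Lemma holds_iff (P : Prop) : holds P = true <-> P.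
Proof. unfold holds. destruct (excluded_middle_informative P); split; intros; auto; discriminate. Qed.

(** Zeros in a square of level k have 1 - |l| >= 2^(-k), while the terms of the Blaschke series tend
    to 0, so only finitely many indices qualify. The second clause compares the count with any
    partial list of such indices. *)
Lemma zero_count_exists (lam : zero_seq) (k j : nat) :
  (forall l, is_zero_of lam l -> unit_disc l) -> blaschke_condition lam ->
  exists N, zero_count lam (whitney k j) N /\
    forall s, NoDup s ->
      (forall n, In n s -> exists l, lam n = Some l /\ whitney k j l) -> (length s <= N)%nat.
Proof.
  intros Hl Hb. pose proof (pow2_pos k) as Hp. pose proof (Rinv_0_lt_compat _ Hp) as Hip.
  assert (Hfin : exists n0, forall n l, lam n = Some l -> whitney k j l -> (n < n0)%nat).
  { pose proof (ex_series_lim_0 _ Hb) as H0.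
    apply is_lim_seq_Reals in H0. destruct (H0 (/ 2 ^ k) Hip) as [n0 Hn0].
    exists n0. intros n l E (r & t & El & Hr & Hk & _). apply Nat.nle_gt. intros Hle.
    specialize (Hn0 n Hle). rewrite E in Hn0. unfold Rdist in Hn0.
    rewrite El, Cmod_polar, (Rabs_right r) in Hn0 by lra.
    rewrite Rminus_0_r, Rabs_right in Hn0 by lra. lra. }
  destruct Hfin as [n0 Hn0].
  set (s0 := filter (fun n => holds (exists l, lam n = Some l /\ whitney k j l)) (seq 0 n0)).
  assert (Hs0 : forall n, In n s0 <-> exists l, lam n = Some l /\ whitney k j l).
  { intros n. unfold s0. rewrite filter_In, holds_iff, in_seq. split; [tauto|].
    intros (l & E & Hw). split; [|exists l; tauto]. pose proof (Hn0 n l E Hw). lia. }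
  exists (length s0). split.
  - exists s0. split; [apply NoDup_filter, seq_NoDup | split; [reflexivity | exact Hs0]].
  - intros s Hnd Hs. apply NoDup_incl_length; [exact Hnd|].
    intros n Hn. apply Hs0, Hs, Hn.
Qed.

Lemma pseudohyp_dist_le (lam : zero_seq) (z l : C) (x : R) :
  is_zero_of lam l -> Rbar_le x (pseudohyp_dist z lam) -> x <= pseudohyp z l.
Proof.
  intros Hl Hx. unfold pseudohyp_dist in Hx.
  match type of Hx with Rbar_le _ (Glb_Rbar ?E) => destruct (Glb_Rbar_correct E) as [Hlb _] end.
  assert (H0 : Rbar_le x (pseudohyp z l)); [|exact H0].
  eapply Rbar_le_trans; [exact Hx|]. apply Hlb. exists l. split; [exact Hl | reflexivity].
Qed.

Lemma near_zero_count (lam : zero_seq) (H H1 : C -> R) (z : C) (k j n : nat) :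
  (forall l, is_zero_of lam l -> unit_disc l) -> blaschke_condition lam ->
  Har_plus H -> Har_plus H1 ->
  (forall k j N : nat, (j < 2 ^ k)%nat ->
     zero_count lam (whitney k j) N -> (0 < N)%nat ->
     INR N * H (whitney_center k j) <= H1 (whitney_center k j)) ->
  unit_disc z ->
  INR (length (filter (fun m => holds ((j < 2 ^ k)%nat /\
      exists l, lam m = Some l /\ whitney k j l /\ pseudohyp z l < 1 / 3)) (seq 0 n))) * H z
  <= Harnack_const ^ 2 * H1 z.
Proof.
  intros Hl Hb HH HH1 HA Hz.
  pose proof (proj2 HH z Hz) as Pz. pose proof (proj2 HH1 z Hz) as P1z.
  assert (HC : 0 < Harnack_const) by apply exp_pos.
  set (s := filter _ _).
  assert (Hs : forall m, In m s -> (j < 2 ^ k)%nat /\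
    exists l, lam m = Some l /\ whitney k j l /\ pseudohyp z l < 1 / 3).
  { intros m Hm. apply filter_In in Hm. apply holds_iff, Hm. }
  (* Without a near zero in the square Harnack has nothing to start from, but the left side is then
     0; otherwise one near zero serves the whole square. *)
  destruct s as [|m0 s'] eqn:Es.
  { simpl. rewrite Rmult_0_l. apply Rmult_le_pos; [apply pow2_ge_0 | lra]. }
  destruct (Hs m0 (or_introl eq_refl)) as (Hj & l & El & Hw & Hn).
  destruct (near_whitney_Harnack k j z l H Hj Hw Hz Hn HH) as [K1 _].
  destruct (near_whitney_Harnack k j z l H1 Hj Hw Hz Hn HH1) as [_ K2].
  destruct (zero_count_exists lam k j Hl Hb) as (N & HN & Hmax).
  assert (Hlen : (length (m0 :: s') <= N)%nat).
  { apply Hmax.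
    - rewrite <- Es. apply NoDup_filter, seq_NoDup.
    - intros m Hm. destruct (Hs m Hm) as (_ & l' & H2 & H3 & _). exists l'. tauto. }
  assert (HNpos : (0 < N)%nat) by (simpl in Hlen; lia).
  pose proof (HA k j N Hj HN HNpos) as HAN.
  apply le_INR in Hlen. pose proof (pos_INR N).
  apply Rle_trans with (INR N * (Harnack_const * H (whitney_center k j))).
  { apply Rle_trans with (INR N * H z); [apply Rmult_le_compat_r; lra|].
    apply Rmult_le_compat_l; assumption. }
  nra.
Qed.

Theorem theorem5 (B : C -> C) (lam : zero_seq) (H : C -> R)
  (hB : is_blaschke_product B lam)
  (hH : Har_plus H)
  (hA : exists H1 : C -> R, Har_plus H1 /\
     forall k j N : nat, (j < 2 ^ k)%nat ->
       zero_count lam (whitney k j) N -> (0 < N)%nat ->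
       INR N * H (whitney_center k j) <= H1 (whitney_center k j)) :
  has_harmonic_majorant (neg_log_abs B)
    (fun z => unit_disc z /\ Rbar_le (exp (- H z)) (pseudohyp_dist z lam)).
Proof.
  destruct hB as (Hl & Hb & u & Hu & HB). destruct hA as (H1 & HH1 & HA).
  (* Empty slots get weight 0 and the dummy point 0, so the series runs over all indices and every
     point has modulus at most 1. *)
  set (c := fun n => match lam n with Some l => 1 - Cmod l ^ 2 | None => 0 end).
  set (p := fun n => match lam n with Some l => l | None => RtoC 0 end).
  assert (Hp : forall n, Cmod (p n) <= 1).
  { intros n. unfold p. destruct (lam n) as [l|] eqn:E; [|rewrite Cmod_0; lra].
    assert (unit_disc l) by (apply Hl; exists n; exact E). unfold unit_disc in *. lra. }
  assert (Hc : forall n, 0 <= c n <= 2 * match lam n with Some l => 1 - Cmod l | None => 0 end).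
  { intros n. unfold c. destruct (lam n) as [l|] eqn:E; [|lra].
    assert (unit_disc l) by (apply Hl; exists n; exact E). unfold unit_disc in *.
    pose proof (Cmod_ge_0 l). split; nra. }
  assert (Hcs : ex_series c).
  { apply (ex_series_le (K := R_AbsRing) (V := R_CompleteNormedModule) c
      (fun n => 2 * match lam n with Some l => 1 - Cmod l | None => 0 end)).
    - intros n. unfold norm; simpl; unfold abs; simpl. rewrite Rabs_right; [|apply Rle_ge]; apply Hc.
    - exact (ex_series_scal_l 2 (fun n => match lam n with Some l => 1 - Cmod l | None => 0 end) Hb). }
  assert (Hc0 : forall n, 0 <= c n) by (intros n; apply Hc).
  set (al := fun _ : nat => RtoC 2).
  assert (Hal : bounded_seq al) by apply bounded_seq_const.
  (* Harmonic bound for the cost of one far zero: [neg_ln_le] combined with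
     [one_minus_pseudohyp2_le]. *)
  set (g := fun z n => 9 / 2 * (c n * (Re (2 * cauchy_term (p n) z ^ 1) - 1))).
  assert (Hg0 : forall z n, unit_disc z -> 0 <= g z n).
  { intros z n Hz. unfold g. pose proof (kernel_ge_0 z (p n) Hz (Hp n)). pose proof (Hc0 n).
    assert (0 <= c n * (Re (2 * cauchy_term (p n) z ^ 1) - 1)) by (apply Rmult_le_pos; assumption).
    lra. }
  (* The -1 in each kernel sums to the constant - 9/2 Series c, leaving a Cauchy series already
     known to be harmonic. *)
  assert (Hgs : forall z, unit_disc z -> ex_series (g z) /\
    Series (g z) = 9 / 2 * cauchy_series c p al 1 z + - (9 / 2) * Series c).
  { intros z Hz. pose proof (ex_cauchy_series c p al 1 z Hc0 Hcs Hp Hal Hz) as E1.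
    assert (E2 : forall n, 9 / 2 * (c n * Re (al n * cauchy_term (p n) z ^ 1) - c n) = g z n)
      by (intros n; unfold g, al; ring).
    pose proof (ex_series_minus _ _ E1 Hcs) as E3. split.
    - apply (ex_series_ext _ _ E2). apply (ex_series_scal_l (9 / 2) (fun n => c n * Re (al n * cauchy_term (p n) z ^ 1) - c n)), E3.
    - rewrite <- (Series_ext _ _ E2), Series_scal_l, Series_minus by assumption.
      unfold cauchy_series. ring. }
  set (M := 99 * Harnack_const ^ 2).
  assert (HM : 0 < M) by (unfold M; assert (0 < Harnack_const) by apply exp_pos; nra).
  exists (fun z => 1 * (9 / 2 * cauchy_series c p al 1 z + - (9 / 2) * Series c) + M * H1 z).
  split; [split|].
  - apply (harmonic_lin unit_disc (fun z => 9 / 2 * cauchy_series c p al 1 z + - (9 / 2) * Series c) H1);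
      [apply unit_disc_open | | apply HH1].
    apply (harmonic_lin unit_disc (cauchy_series c p al 1) (fun _ => Series c));
      [apply unit_disc_open | apply cauchy_series_harmonic; assumption
      | apply harmonic_const, unit_disc_open].
  (* Strict positivity comes from M * H1; the series alone vanishes when there are no zeros. *)
  - intros z Hz. destruct (Hgs z Hz) as [E1 E2]. rewrite <- E2.
    pose proof (lsum_le_Series (g z) 0 (fun n => Hg0 z n Hz) E1) as H0. simpl in H0.
    pose proof (proj2 HH1 z Hz). nra.
  - intros z [Hz Hd]. destruct (Hgs z Hz) as [E1 E2].
    set (h2 := 1 * (9 / 2 * cauchy_series c p al 1 z + - (9 / 2) * Series c) + M * H1 z).
    pose proof (proj2 hH z Hz) as Pz.
    assert (Hrho : forall l, is_zero_of lam l -> exp (- H z) <= pseudohyp z l)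
      by (intros l Hz0; apply (pseudohyp_dist_le lam); assumption).
    destruct (near_cells z Hz) as (L & HL & HLin).
    (* The bound is independent of n: far zeros are absorbed by the full series of [g], near ones by
       the 99 cells. *)
    assert (Hcost : forall n, lsum (zero_cost lam z) (seq 0 n) <= h2).
    { intros n.
      pose proof (lsum_covering (zero_cost lam z) (g z)
        (fun (kj : nat * nat) m => holds ((snd kj < 2 ^ fst kj)%nat /\
           exists l, lam m = Some l /\ whitney (fst kj) (snd kj) l /\ pseudohyp z l < 1 / 3))
        (H z) (Harnack_const ^ 2 * H1 z) (seq 0 n) L) as Hcov.
      eapply Rle_trans; [apply Hcov|].
      - lra.
      - intros m _. unfold zero_cost. destruct (lam m) as [l|] eqn:El.
        + assert (Hlz : is_zero_of lam l) by (exists m; exact El).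
          destruct (Rlt_le_dec (pseudohyp z l) (1 / 3)) as [Hn|Hn].
          * right. split; [apply Hg0, Hz|]. split.
            -- pose proof (Hrho l Hlz) as Hr. apply ln_le in Hr; [|apply exp_pos].
               rewrite ln_exp in Hr. lra.
            -- destruct (whitney_cover l (Hl l Hlz)) as (k & j & Hj & Hw).
               exists (k, j). split; [exact (HLin k j l Hj Hw Hn)|].
               apply holds_iff. simpl. split; [exact Hj | exists l; tauto].
          * left. eapply Rle_trans; [apply neg_ln_le; split; [exact Hn | apply pseudohyp_le_1; auto]|]. unfold g.
            apply Rmult_le_compat_l; [lra|].
            unfold c, p. rewrite El. apply one_minus_pseudohyp2_le; [exact Hz | apply Hl, Hlz].
        + left. apply Hg0, Hz.
      - intros [k j]. apply near_zero_count; assumption.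
      - rewrite HL. replace (INR 99) with 99 by (simpl; ring).
        pose proof (lsum_le_Series (g z) n (fun n => Hg0 z n Hz) E1) as H0. rewrite E2 in H0.
        unfold h2, M. lra. }
    (* The lower bound is positive, so it also rules out the branch where [neg_log_abs] is +oo. *)
    assert (HBz : exp (- h2) <= Cmod (B z)).
    { apply (Cmod_limit_ge u (B z) (fun n => blaschke_partial lam n z)); [exact Hu | | apply HB, Hz].
      intros n. rewrite Cmod_blaschke_partial.
      - apply exp_le_compat. specialize (Hcost n). lra.
      - exact Hz.
      - intros l Hlz. split; [apply Hl, Hlz|].
        eapply Rlt_le_trans; [apply exp_pos | apply Hrho, Hlz]. }
    pose proof (exp_pos (- h2)) as Hpos.
    unfold neg_log_abs. destruct (Req_EM_T (Cmod (B z)) 0) as [E|E]; [lra|].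
    simpl. apply ln_le in HBz; [|exact Hpos]. rewrite ln_exp in HBz. fold h2. lra.
Qed.
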